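(* Let $H\in\mathbb{R}^{n\times n}$, $\mathcal{E}\subset\mathbb{R}$ and $z\in\mathbb{C}\setminus\mathcal{E}$ be as in the setting described in the context, and let $H-zI=LDL^T$ with $L$ lower-triangular with unit diagonal and $D$ diagonal. Then for all $i\ge j$ in $\{1,\dots,n\}$, $$|L(i,j)|\;\lesssim_\varepsilon\;\exp\bigl(-g_{\mathcal{E}}(z)\,\mathrm{level}(i,j)\bigr),$$ i.e. for every $\tilde\alpha<g_{\mathcal{E}}(z)$ there is a constant $C(\tilde\alpha)$, independent of $n,i,j$, such that $|L(i,j)|\le C(\tilde\alpha)\exp(-\tilde\alpha\,\mathrm{level}(i,j))$.
   Context: Setting: $H\in\mathbb{R}^{n\times n}$ ranges over a family of real symmetric sparse matrices of varying size $n$; sparse means that the number of nonzero entries per row and column is bounded independently of $n$. $\mathcal{E}\subset\mathbb{R}$ is a compact, non-polar set (i.e. of positive logarithmic capacity), independent of $n$, such that the spectra of all leading submatrices $H(\ell,\ell)$ with $\ell=\{1,\dots,i\}$, $i=1,\dots,n$, are contained in $\mathcal{E}$. The point $z\in\mathbb{C}\setminus\mathcal{E}$ is fixed. $g_{\mathcal{E}}:\mathbb{C}\to[0,\infty)$ is the Green's function (with pole at infinity) of the complement of $\mathcal{E}$. Graph notions: $G(H)$ is the graph with vertex set $\{1,\dots,n\}$ and edges $(j,i)$ for all $H(i,j)\neq0$. A fill path between $i$ and $j$ is a path $i,k_1,\dots,k_p,j$ in $G(H)$ with $k_1,\dots,k_p<\min\{i,j\}$. Let $d_{\mathrm{fill}}(i,j)$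 be the minimal number of edges on any fill path between $i$ and $j$ ($\infty$ if none exists). The level-of-fill is $\mathrm{level}(i,j):=\max\{0,d_{\mathrm{fill}}(i,j)-1\}$. Convention: $\exp(-\infty)=0$. Notation $\lesssim_\varepsilon$: $a_k\lesssim_\varepsilon\exp(-\alpha k)$ means that for all $\tilde\alpha<\alpha$ there exists $C(\tilde\alpha)$ with $a_k\le C(\tilde\alpha)\exp(-\tilde\alpha k)$ for all $k$. *)

(* Defs.v *)
From mathcomp Require Import all_boot all_order all_algebra.
From mathcomp Require Import all_classical all_reals all_analysis.
From mathcomp Require Import complex.

Set Implicit Arguments.
Unset Strict Implicit.
Unset Printing Implicit Defensive.

Import Order.TTheory GRing.Theory Num.Theory.
Import numFieldNormedType.Exports.

Local Open Scope classical_set_scope.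
Local Open Scope ring_scope.
Local Open Scope complex_scope.

(* Moduli of complex numbers are taken with [Normc.normc], which is
   R-valued, whereas the generic norm on R[i] is R[i]-valued. *)
Notation cabs := Normc.normc.

Section PotentialTheory.
Variable R : realType.
Implicit Types (E A K : set R) (g : R[i] -> R) (u : R * R -> R).

Definition off E : set R[i] := ~` [set x%:C | x in E].

(* [lne 0 = -oo], so that the diagonal counts as +oo; with [ln] it would
   count as 0. *)
Definition log_energy (mu : probability R R) : \bar R :=
  (\int[mu]_x \int[mu]_y - lne `|x - y|%:E)%E.

(* The logarithmic capacity of A is the supremum of exp (- log_energy mu) over
   the mu below, hence polar means zero capacity. Only subsets of the real line
   are needed. *)
Definition polar A : Prop :=
  forall (mu : probability R R) K,
    compact K -> K `<=` A -> mu (~` K) = 0%E -> log_energy mu = +oo%E.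

Definition on_plane g : R * R -> R := fun p => g (p.1 +i* p.2).

Definition plane_off E : set (R * R) := [set p | off E (p.1 +i* p.2)].

Definition dx u : R * R -> R := 'D_((1, 0) : R * R) u.
Definition dy u : R * R -> R := 'D_((0, 1) : R * R) u.

Definition C1_on (U : set (R * R)) u : Prop :=
  forall p, U p ->
    [/\ derivable u p (1, 0), derivable u p (0, 1),
        {for p, continuous (dx u)} & {for p, continuous (dy u)}].

Definition harmonic_on (U : set (R * R)) u : Prop :=
  [/\ C1_on U u, C1_on U (dx u), C1_on U (dy u) &
      forall p, U p -> dx (dx u) p + dy (dy u) p = 0].

(* Green's function with pole at infinity of the complement of E, for E compact
   in the real line (so that E is the boundary of its complement): harmonic,
   bounded away from the pole, log |z| + O(1) at the pole, and with boundary
   values 0 outside a Borel polar set. These properties determine g off E when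
   E is not polar; the values of g on E are left free. *)
Definition is_green E g : Prop :=
  [/\ forall z, 0 <= g z,
      harmonic_on (plane_off E) (on_plane g),
      forall r : R, exists M : R,
        forall z, off E z -> cabs z <= r -> g z <= M,
      exists r M : R,
        forall z, off E z -> r <= cabs z -> `|g z - ln (cabs z)| <= M &
      exists2 Z : set R, measurable Z /\ polar Z &
        forall x, E x -> ~ Z x ->
          on_plane g @ within (plane_off E) (nbhs (x, 0)) --> (0 : R)].

End PotentialTheory.

Section Fill.
Variables (R : realType) (n : nat) (H : 'M[R]_n).

Definition adj : rel 'I_n := fun j i => H i j != 0.

(* The path is i :: p, with [size p] edges and inner vertices
   [behead (belast i p)]. When i = j the empty p is allowed: d_fill i i = 0,
   which is the case for which level is truncated at 0. *)
Definition fill_path (i j : 'I_n) (p : seq 'I_n) : bool :=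
  [&& path adj i p, last i p == j &
      all (fun k : 'I_n => (k < minn i j)%N) (behead (belast i p))].

Definition d_fill (i j : 'I_n) : \bar R :=
  ereal_inf [set (size p)%:R%:E | p in [set p | fill_path i j p]].

Definition level (i j : 'I_n) : \bar R := maxe 0%E (d_fill i j - 1)%E.

Definition sparse_mx (s : nat) : Prop :=
  (forall i, (#|[pred j | (H i j != 0)%R]| <= s)%N) /\
  (forall j, (#|[pred i | (H i j != 0)%R]| <= s)%N).

Definition lead_submx (i : nat) (le_in : (i <= n)%N) : 'M[R]_i :=
  mxsub (widen_ord le_in) (widen_ord le_in) H.

Definition cmx : 'M[R[i]]_n := map_mx (real_complex R) H.

End Fill.

Definition lead_spectra_in (R : realType) (n : nat) (E : set R) (H : 'M[R]_n) :
  Prop :=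
  forall (i : nat) (le_in : (i <= n)%N) (a : R[i]),
    eigenvalue (cmx (lead_submx H le_in)) a -> [set x%:C | x in E] a.

Definition is_LDL (K : fieldType) (n : nat) (A L D : 'M[K]_n) : Prop :=
  [/\ is_trig_mx L, forall i, L i i = 1, is_diag_mx D &
      A = L *m D *m L^T].

(* Main.v *)
(** Let S be a leading block of H and A = H - zI. Since L (i, .) restricted to the
    block is A (i, .) (S - z)^-1 times the lower factor of the block, L (i, j) is a
    sum of at most s terms H (i, k) (S - z)^-1 (k, j). If p has degree less than m
    then p (S) (k, j) = 0 as soon as no fill path has m edges or fewer, so the
    spectral theorem bounds (S - z)^-1 (k, j) by the distance on E from 1 / (x - z)
    to such p, that is, by the sup norm on E of a polynomial q of degree m with
    q (z) = 1. By taking powers it is enough to find one polynomial q of degree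
    n > 0 with |q (z)| >= exp (a n) sup_E |q|.

    Such a q is built from Fekete points x_l of E, the factor of the point with the
    smallest Lagrange denominator being omitted. Then sup_E |q| = exp B, and at
    distance r = exp (- eps n) from the Fekete points ln |q| >= B - 4 eps n. The
    maximum principle compares g with (ln |q| - B) / n in the domain at distance at
    least r from E, and this gives g (z) up to a multiple of eps. It requires g to
    be small near all of E, whereas g tends to 0 only off a polar set: the points
    of E near which g exceeds eps form a compact polar set K, and a small multiple
    of ln |Q|, with Q a monic polynomial very small on K, is added to g.

    Q exists because otherwise the Fekete points of K have bounded discrete
    potentials; their sorted lists, read as monotone step functions on [0, 1[,
    converge along a subsequence, and Fatou's lemma shows that the image of the
    uniform law under the limit is a measure of finite energy on K. *)

Require Import Defs.
From mathcomp Require Import all_boot all_order all_algebra.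
From mathcomp Require Import all_classical all_reals all_analysis.
From mathcomp Require Import complex measurable_realfun ring lra.

Set Implicit Arguments.
Unset Strict Implicit.
Unset Printing Implicit Defensive.

Import Order.TTheory GRing.Theory Num.Theory.
Import numFieldNormedType.Exports.
Import HBNNSimple.

Local Open Scope classical_set_scope.
Local Open Scope ring_scope.
Local Open Scope complex_scope.

(** * Decay of the entries of L from polynomial approximation *)

Lemma normc_cabs (R : rcfType) (x : R[i]) : `|x| = (cabs x)%:C.
Proof. by case: x => a b; rewrite normc_def. Qed.

Lemma cabs_le (R : rcfType) (x : R[i]) (c : R) : (cabs x <= c) = (`|x| <= c%:C).
Proof. by rewrite normc_cabs lecR. Qed.

Lemma cabs_ge0 (R : rcfType) (x : R[i]) : 0 <= cabs x.
Proof. by case: x => a b; exact: sqrtr_ge0. Qed.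

(** The columns of [U] have norm 1; bounding the product of two moduli in a row by half the sum of
    their squares gives what Cauchy-Schwarz would. *)
Lemma unitary_conj_entry_le (C : numClosedFieldType) n (U : 'M[C]_n)
    (v : 'rV[C]_n) (c : C) (k l : 'I_n) :
  U \is unitarymx -> (forall m, `|v 0 m| <= c) ->
  `|(invmx U *m diag_mx v *m U) k l| <= c.
Proof.
move=> Uu vc; have c0 : 0 <= c by apply: le_trans (normr_ge0 _) (vc k).
have colE a : \sum_m `|U m a| ^+ 2 = 1.
  have := mulVmx (unitarymx_unit Uu); rewrite invmx_unitary//.
  move=> /matrixP/(_ a a); rewrite !mxE eqxx => UaE; apply: etrans UaE.
  by apply: eq_bigr => m _; rewrite !mxE normCK mulrC.
rewrite invmx_unitary// mxE; under eq_bigr => m _.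
  rewrite mul_mx_diag !mxE.
  over.
apply: le_trans (ler_norm_sum _ _ _) _.
apply: (@le_trans _ _ (\sum_m (c * ((`|U m k| ^+ 2 + `|U m l| ^+ 2) / 2)))).
  apply: ler_sum => m _; rewrite !normrM norm_conjC [X in X * _]mulrC -mulrA.
  apply: ler_pM => //.
  rewrite ler_pdivlMr// -subr_ge0 [X in 0 <= X](_ : _ =
    (`|U m k| - `|U m l|) ^+ 2); last by rewrite sqrrB mulr_natr; ring.
  by rewrite -realEsqr rpredB// normr_real.
by rewrite -mulr_sumr -mulr_suml big_split/= !colE -mulr2n divff ?mulr1// pnatr_eq0.
Qed.

Lemma real_sym_diag (R : realType) n (S : 'M[R]_n) : S^T = S ->
  exists U : 'M[R[i]]_n, exists v : 'rV[R[i]]_n,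
    [/\ U \is unitarymx, cmx S = invmx U *m diag_mx v *m U &
        forall m, eigenvalue (cmx S) (v 0 m)].
Proof.
move=> Ssym; have Sn : cmx S \is normalmx.
  apply/normalmxP; suff -> : map_mx Num.conj (cmx S)^T = cmx S by [].
  rewrite /cmx map_trmx Ssym -map_mx_comp; apply/matrixP => i j; rewrite !mxE.
  exact: conjc_real.
exists (spectralmx (cmx S)), (spectral_diag (cmx S)); split.
- exact: spectral_unitarymx.
- exact/orthomx_spectralP.
- move=> m; apply/eigenvalueP; exists (row m (spectralmx (cmx S))).
    rewrite {2}(orthomx_spectralP Sn) !mulmxA -row_mul mulmxV ?spectral_unit//.
    rewrite row1 -rowE; apply/rowP => j; rewrite !mxE (bigD1 m)//= big1 => [|i im].
      by rewrite !mxE eqxx addr0 mulr1n.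
    by rewrite !mxE eq_sym (negPf im) mulr0n mul0r.
  apply/eqP => r0; have := spectral_unit (cmx S); rewrite -row_free_unit.
  move=> /row_freeP[B /(congr1 (row m))]; rewrite row_mul r0 mul0mx row1.
  by move=> /rowP/(_ m); rewrite !mxE !eqxx => /eqP; rewrite eq_sym oner_eq0.
Qed.

(** [H] is its own leading block of order [n], so its eigenvalues lie in [E], and unitary
    conjugation keeps the entries below the largest modulus of an eigenvalue. *)
Lemma lead_entry_le (R : realType) (E : set R) (b : R) n (H : 'M[R]_n) (i k : 'I_n) :
  (forall x, E x -> `|x| <= b) -> H^T = H -> lead_spectra_in E H ->
  `|H i k| <= b.
Proof.
move=> Eb Hs Hspec; have [U [v [Uu HE vE]]] := real_sym_diag Hs.
have := @unitary_conj_entry_le _ _ U v b%:C i k Uu.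
rewrite -HE mxE normc_cabs lecR /= expr0n addr0 sqrtr_sqr; apply => m.
have : eigenvalue (cmx (lead_submx H (leqnn n))) (v 0 m).
  suff -> : lead_submx H (leqnn n) = H by [].
  by apply/matrixP => a c; rewrite mxE; congr (H _ _); apply: val_inj.
move=> /Hspec[x /Eb xb <-].
by rewrite normc_cabs /= expr0n addr0 sqrtr_sqr lecR.
Qed.

(** A nonzero entry of a power comes from a walk, cut here at its first visit to [l]. When [l] is
    the last index of a block, avoiding [l] before the end makes all other vertices smaller than
    [l], as a fill path requires. *)
Lemma mx_expr_path (K : pzRingType) n (S : 'M[K]_n.+1) (l : 'I_n.+1) e k :
  (S ^+ e) k l != 0 ->
  exists p, [/\ (size p <= e)%N, path (fun a c => S a c != 0) k p,
                last k p = l & all (predC1 l) (belast k p)].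
Proof.
elim: e k => [|e IH] k.
  rewrite expr0 mxE; have [<- _|_] := eqVneq k l; last by rewrite mulr0n eqxx.
  by exists [::].
have [-> _|kl] := eqVneq k l; first by exists [::].
rewrite exprS mxE => S0.
have /existsP[m /andP[]] : [exists m, (S k m != 0) && ((S ^+ e) m l != 0)].
  apply: contraNT S0; rewrite negb_exists => /forallP S0.
  apply/eqP; apply: big1 => m _; have := S0 m.
  by rewrite negb_and !negbK => /orP[]/eqP->; rewrite ?mul0r ?mulr0.
move=> km /IH[p [sp pp lp ap]]; exists (m :: p); split => //=; first by rewrite km.
by rewrite kl.
Qed.

Lemma horner_mx_entry0 (K : comNzRingType) n (S : 'M[K]_n.+1) (p : {poly K}) (k l : 'I_n.+1) :
  (forall e, (e < size p)%N -> (S ^+ e) k l = 0) -> horner_mx S p k l = 0.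
Proof.
move=> S0; rewrite -[p in LHS]coefK poly_def rmorph_sum/= summxE big1// => e _.
by rewrite -mul_polyC rmorphM/= horner_mx_C rmorphXn/= horner_mx_X -mulmxE mul_scalar_mx mxE S0 ?mulr0.
Qed.

Lemma horner_mx_conj_diag (F : fieldType) n (U : 'M[F]_n.+1) (v : 'rV[F]_n.+1) (p : {poly F}) :
  U \in unitmx -> horner_mx (invmx U *m diag_mx v *m U) p =
                  invmx U *m diag_mx (map_mx (horner p) v) *m U.
Proof. by move=> Uu; rewrite horner_mx_uconjC// horner_mx_diag. Qed.

(* With [q = 1 - p * ('X - z)], this is 1 / (x - z) = p (x) + q (x) / (x - z). *)
Lemma invmx_conj_diag (F : fieldType) n (U A : 'M[F]_n.+1) (v : 'rV[F]_n.+1) (z : F) (p : {poly F}) :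
  U \in unitmx -> A = invmx U *m diag_mx v *m U -> (forall m, v 0 m - z != 0) ->
  A - z%:M \in unitmx /\ invmx (A - z%:M) = horner_mx A p +
    invmx U *m diag_mx (map_mx (fun x => (1 - p * ('X - z%:P)).[x] / (x - z)) v) *m U.
Proof.
move=> Uu AE vz.
have AzE : A - z%:M = invmx U *m diag_mx (map_mx (fun x => x - z) v) *m U.
  have -> : A - z%:M = horner_mx A ('X - z%:P).
    by rewrite rmorphB/= horner_mx_X horner_mx_C.
  rewrite AE horner_mx_conj_diag//; congr (_ *m diag_mx _ *m _).
  by apply/rowP => m; rewrite !mxE !hornerE.
have AzV : (A - z%:M) *m
    (invmx U *m diag_mx (map_mx (fun x => (x - z)^-1) v) *m U) = 1%:M.
  rewrite AzE !mulmxA mulmxK// -!mulmxA (mulmxA (diag_mx _)) mulmx_diag.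
  rewrite [diag_mx _](_ : _ = 1%:M) ?mul1mx ?mulVmx//.
  by apply/matrixP => a m; rewrite !mxE mulfV.
have [Azu _] := mulmx1_unit AzV; split=> //.
rewrite -[LHS]mulmx1 -AzV mulmxA mulVmx// mul1mx {1}AE horner_mx_conj_diag//.
rewrite -mulmxDl -mulmxDr; congr (_ *m _ *m _); apply/matrixP => a m; rewrite !mxE.
by rewrite -mulrnDl; congr (_ *+ _); rewrite !hornerE mulrBl mul1r mulfK// addrC subrK.
Qed.

(** With [q = 1 - p * ('X - z%:P)] the polynomial [p] has one coefficient fewer than [q], so the
    entry of [p (S)] vanishes and only [q (x) / (x - z)], taken at the eigenvalues, contributes. *)
Lemma resolvent_entry_le (R : realType) (E : set R) (z : R[i]) (delta c : R)
    n (S : 'M[R]_n.+1) (q : {poly R[i]}) (k l : 'I_n.+1) :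
  S^T = S -> (forall a, eigenvalue (cmx S) a -> [set x%:C | x in E] a) ->
  0 < delta -> (forall x, E x -> delta <= cabs (x%:C - z)) ->
  q.[z] = 1 -> (forall x, E x -> cabs q.[x%:C] <= c) ->
  (forall e, (e < (size q).-1)%N -> (cmx S ^+ e) k l = 0) ->
  cmx S - z%:M \in unitmx /\
  cabs (invmx (cmx S - z%:M) k l) <= c / delta.
Proof.
move=> Ss Sspec d0 dE qz qc Skl.
have [U [v [Uu SE vS]]] := real_sym_diag Ss.
have vz m : v 0 m - z != 0.
  have /Sspec[x /dE xd <-] := vS m.
  by apply: contraTN xd => /eqP ->; rewrite Normc.normc0 -ltNge.
have [p pE] : exists p, q = 1 - p * ('X - z%:P).
  have /factor_theorem[p pE] : root (1 - q) z by rewrite /root !hornerE qz subrr.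
  by exists p; rewrite -pE opprB addrC subrK.
have [Szu invE] := invmx_conj_diag p (unitarymx_unit Uu) SE vz; rewrite -pE in invE.
split=> //.
rewrite invE mxE horner_mx_entry0 ?add0r; last first.
  move=> e ep; apply: Skl; apply: leq_trans ep _.
  have [->|p0] := eqVneq p 0; first by rewrite size_poly0.
  have spX : size (p * ('X - z%:P)) = (size p).+1.
    by rewrite size_Mmonic ?monicXsubC// size_XsubC addn2.
  rewrite pE addrC size_polyDl size_polyN spX// size_poly1 ltnS size_poly_gt0//.
rewrite cabs_le; apply: unitary_conj_entry_le => // m; rewrite !mxE -cabs_le.
have /Sspec[x Ex <-] := vS m.
rewrite Normc.normcM Normc.normcV; apply: ler_pM.
- exact: cabs_ge0.
- by rewrite invr_ge0 cabs_ge0.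
- exact: qc.
- by rewrite lef_pV2 ?dE// ?posrE//; exact: lt_le_trans (dE _ Ex).
Qed.

(** As [L^T] is upper triangular and [D] diagonal, the first [j] columns of the product involve only
    the first [j] columns of [L]. *)
Lemma LDL_colsub (K : fieldType) n (A L D : 'M[K]_n) j (le_jn : (j <= n)%N)
    (w := widen_ord le_jn) :
  is_LDL A L D ->
  colsub w A = colsub w L *m (mxsub w w D *m (mxsub w w L)^T).
Proof.
case=> /is_trig_mxP Lt _ /is_diag_mxP Dd ->; apply/matrixP => a k.
rewrite !mxE (bigID (fun b : 'I_n => b < j)%N)/= [X in _ + X]big1 ?addr0; last first.
  move=> b; rewrite -leqNgt => jb; rewrite [X in _ * X]mxE Lt ?mulr0//=.
  exact: leq_trans (ltn_ord k) jb.
under eq_bigl => b do rewrite -[(b < j)%N]/((b : nat) < j)%N.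
rewrite (big_ord_narrow le_jn); apply: eq_bigr => b _; rewrite !mxE.
rewrite (bigD1 (w b))//= big1 ?addr0; last first.
  by move=> c cb; rewrite Dd ?mulr0//; apply: contraNneq cb => /val_inj ->.
rewrite (bigD1 b)//= big1 ?addr0 ?mxE ?mulrA//.
move=> c cb; rewrite mxE Dd ?mul0r//=; apply: contraNneq cb => bc.
by apply/eqP/val_inj.
Qed.

(** The block has order [j + 1], with [j] as its last index. The last column of its unit lower
    triangular factor is a unit vector, so multiplying by this factor does not change the entry at
    [j]. *)
Lemma LDL_entry (K : fieldType) n (A L D : 'M[K]_n) (i j : 'I_n)
    (w := widen_ord (ltn_ord j)) :
  is_LDL A L D -> mxsub w w A \in unitmx ->
  L i j = \sum_k A i (w k) * invmx (mxsub w w A) k ord_max.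
Proof.
move=> LDL Au; have AE := LDL_colsub (ltn_ord j) LDL; rewrite -/w in AE.
have [/is_trig_mxP Lt L1 _ _] := LDL.
set B := _ *m _^T in AE.
have AwE : mxsub w w A = mxsub w w L *m B.
  by apply/matrixP => a b; move/matrixP/(_ (w a) b): AE; rewrite !mxE => ->;
     apply: eq_bigr => c _; rewrite !mxE.
have Bu : B \in unitmx by move: Au; rewrite AwE unitmx_mul => /andP[].
set G := colsub w A *m invmx (mxsub w w A).
have : G *m mxsub w w L = colsub w L.
  apply: (can_inj (mulmxK Bu)).
  by rewrite -mulmxA -AwE -AE /G -mulmxA mulVmx// mulmx1.
have jE : w ord_max = j by apply: val_inj.
move=> /matrixP/(_ i ord_max); rewrite [RHS]mxE jE => <-.
rewrite mxE (bigD1 ord_max)//= big1 ?addr0.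
  rewrite [X in _ * X]mxE L1 mulr1 mxE; apply: eq_bigr => k _.
  by rewrite mxE.
move=> k kj; rewrite [X in _ * X]mxE Lt ?mulr0//=.
by rewrite ltn_neqAle kj -ltnS ltn_ord.
Qed.

Lemma LDL_decay (R : realType) (E : set R) (z : R[i]) (delta b c : R) (s m : nat)
    (q : {poly R[i]}) n (H : 'M[R]_n) (L D : 'M[R[i]]_n) (i j : 'I_n) :
  0 < delta -> (forall x, E x -> delta <= cabs (x%:C - z)) ->
  0 <= b -> (forall x, E x -> `|x| <= b) ->
  (size q <= m.+1)%N -> q.[z] = 1 -> 0 <= c -> (forall x, E x -> cabs q.[x%:C] <= c) ->
  H^T = H -> sparse_mx H s -> lead_spectra_in E H ->
  is_LDL (cmx H - z%:M) L D ->
  (j < i)%N -> (forall p, fill_path H i j p -> (m < size p)%N) ->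
  cabs (L i j) <= s%:R * (b * (c / delta)).
Proof.
move=> d0 dE b0 bE sq qz c0 qc Hs [Hsp _] Hspec LDL ji fillm.
pose w := widen_ord (ltn_ord j); pose S := lead_submx H (ltn_ord j).
have HT a a' : H a a' = H a' a by rewrite -[in LHS]Hs mxE.
have Ss : S^T = S.
  by apply/matrixP => a a'; rewrite !mxE HT.
have SzE : mxsub w w (cmx H - z%:M) = cmx S - z%:M.
  by apply/matrixP => a a'; rewrite !mxE.
have jE : w ord_max = j by apply: val_inj.
have wi k : w k != i.
  by apply: contraTneq ji => <-; rewrite -leqNgt /= -ltnS.
have path0 k e : H i (w k) != 0 -> (e < (size q).-1)%N ->
    (cmx S ^+ e) k ord_max = 0.
  move=> Hik eq; apply: contraTeq isT => /mx_expr_path[p [pe pp lp ap]].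
  (* Prefixing [i] to the path in the block gives a fill path, because every index of the block
     other than [j] is less than [j]. It has at most [e + 1 <= m] edges, which is excluded. *)
  have /fillm : fill_path H i j (w k :: map w p).
    apply/and3P; split => /=.
    - rewrite {1}/adj HT Hik /= path_map; apply: sub_path pp => a a'.
      rewrite /= !mxE => S0; rewrite /adj HT.
      by apply: contraNN S0 => /eqP ->.
    - by rewrite last_map lp jE.
    - rewrite belast_map all_map; apply: sub_all ap => a /= aj.
      rewrite (minn_idPr (ltnW ji)) ltn_neqAle -ltnS ltn_ord andbT.
      by apply: contraNneq aj => aj; apply/eqP/val_inj.
  rewrite /= size_map ltnS => mp; have : (e < m)%N.
    by apply: (leq_trans eq); case: (size q) sq.
  by rewrite ltnNge (leq_trans mp pe).
have resE k : H i (w k) != 0 -> cabs (invmx (cmx S - z%:M) k ord_max) <= c / delta.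
  move=> Hik.
  have := @resolvent_entry_le _ E z delta c _ S q k ord_max Ss (Hspec _ _) d0 dE qz qc.
  by case=> // e; exact: path0.
(* For the constant polynomial 1 the condition on powers is empty, so invertibility comes without
   any information on paths. *)
have Su : cmx S - z%:M \in unitmx.
  have := @resolvent_entry_le _ E z delta 1 _ S 1 ord_max ord_max Ss (Hspec _ _) d0 dE.
  case=> //; first by rewrite hornerE.
    by move=> x _; rewrite hornerE Normc.normc1.
  by move=> e; rewrite size_poly1.
rewrite (LDL_entry _ LDL) SzE// cabs_le; apply: le_trans (ler_norm_sum _ _ _) _.
rewrite (bigID (fun k => H i (w k) != 0))/= [X in _ + X]big1 ?addr0; last first.
  move=> k /negPn/eqP Hik; rewrite !mxE Hik eq_sym (negPf (wi k)) mulr0n subr0.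
  by rewrite mul0r normr0.
apply: (@le_trans _ _ (\sum_(k | H i (w k) != 0) (b * (c / delta))%:C)).
  apply: ler_sum => k Hik; rewrite -cabs_le Normc.normcM; apply: ler_pM.
  - exact: cabs_ge0.
  - exact: cabs_ge0.
  - rewrite !mxE eq_sym (negPf (wi k)) mulr0n subr0.
    by rewrite /= expr0n addr0 sqrtr_sqr (lead_entry_le _ _ bE).
  - exact: resE.
rewrite sumr_const -raddfMn lecR -[leLHS]mulr_natl; apply: ler_wpM2r.
  by rewrite mulr_ge0// divr_ge0// ltW.
have w_inj : injective w by move=> k k' /(congr1 val)/= kk; apply: val_inj.
rewrite ler_nat; apply: leq_trans (Hsp i); rewrite -(fintype.card_image w_inj).
by apply: subset_leq_card; apply/fintype.subsetP => a /fintype.imageP[k Hik ->].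
Qed.

Lemma off_dist (R : realType) (E : set R) (z : R[i]) : compact E -> off E z ->
  exists2 delta : R, 0 < delta & forall x, E x -> delta <= cabs (x%:C - z).
Proof.
case: z => u v cE Ez; have [v0|v0] := eqVneq v 0; last first.
  exists `|v|; first by rewrite normr_gt0.
  by move=> x _; rewrite /= sub0r sqrrN -sqrtr_sqr ler_wsqrtr// lerDr sqr_ge0.
have Eu : (~` E) u by move=> Eu; apply: Ez; exists u => //; rewrite v0.
have : open (~` E) by apply: closed_openC; apply: compact_closed => //; exact: Rhausdorff.
move=> /(_ u Eu)/nbhs_ballP[e /= e0 eE]; exists e => // x Ex.
rewrite v0 /= subr0 expr0n addr0 sqrtr_sqr leNgt; apply/negP => xu.
by have := eE x; rewrite /ball /= distrC => /(_ xu).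
Qed.

Lemma compact_norm_bound (R : realType) (E : set R) : compact E ->
  exists2 b : R, 0 <= b & forall x, E x -> `|x| <= b.
Proof.
move=> /compact_bounded[b [br bE]]; exists (`|b| + 1); first by rewrite addr_ge0.
by apply: bE; rewrite (le_lt_trans (ler_norm b))// ltrDl.
Qed.

(** Take the power [m %/ d] of [q] normalized at [z]; the remainder [m %% d < d] costs at most the
    factor [expR (a *+ d)]. *)
Lemma poly_decay (R : realType) (E : set R) (z : R[i]) (a c : R) (d : nat) (q : {poly R[i]}) :
  0 <= a -> (0 < d)%N -> (size q <= d.+1)%N -> q.[z] != 0 ->
  0 <= c -> (forall x, E x -> cabs q.[x%:C] <= c) ->
  c * expR (a *+ d) <= cabs q.[z] ->
  forall m, exists p : {poly R[i]},
    [/\ (size p <= m.+1)%N, p.[z] = 1 &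
        forall x, E x -> cabs p.[x%:C] <= expR (a *+ d) * expR (- (a *+ m))].
Proof.
move=> a0 d0 sq qz c0 qc qcz m; pose t := (m %/ d)%N.
have qz0 : 0 < cabs q.[z].
  rewrite lt_neqAle cabs_ge0 andbT eq_sym; apply: contra_neq qz; exact: Normc.eq0_normc.
exists ((q.[z]^-1 *: q) ^+ t); split.
- apply: leq_trans (size_poly_exp_leq _ _) _; rewrite ltnS.
  apply: leq_trans (leq_trunc_div m d); rewrite mulnC leq_mul2l; apply/orP; right.
  by rewrite size_scale ?invr_eq0//; case: (size q) sq.
- by rewrite horner_exp hornerZ mulVf// expr1n.
move=> x Ex; rewrite horner_exp hornerZ.
have -> : forall y : R[i], cabs (y ^+ t) = cabs y ^+ t.
  by move=> y; elim: t => [|t IH]; rewrite ?expr0 ?Normc.normc1// !exprS Normc.normcM IH.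
rewrite Normc.normcM Normc.normcV.
have xd : (cabs q.[z])^-1 * cabs q.[x%:C] <= expR (- (a *+ d)).
  rewrite ler_pdivrMl// (le_trans (qc x Ex))// expRN -ler_pdivrMr ?invr_gt0 ?expR_gt0//.
  by rewrite invrK.
apply: (@le_trans _ _ (expR (- (a *+ d)) ^+ t)).
  by rewrite lerXn2r// ?nnegrE ?mulr_ge0 ?invr_ge0 ?cabs_ge0 ?expR_ge0.
rewrite -expRM_natl -expRD ler_expR -(mulr_natl a d) -(mulr_natl a m).
rewrite (_ : m%:R = t%:R * d%:R + (m %% d)%:R); last first.
  by rewrite -natrM -natrD -divn_eq.
have : (m %% d)%:R <= d%:R :> R by rewrite ler_nat ltnW// ltn_pmod.
by move: (t%:R) (d%:R) (_%:R) => u v w; nra.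
Qed.

(** For [j < i] a fill path has at least one edge, so the truncation of the level at 0 has no effect
    and level [m] means at least [m + 1] edges. *)
Lemma fill_level_le (R : realType) n (H : 'M[R]_n) (i j : 'I_n) :
  (j < i)%N ->
  (level H i j = +oo%E /\ forall p, ~~ fill_path H i j p) \/
  exists m, level H i j = m%:R%:E /\ forall p, fill_path H i j p -> (m < size p)%N.
Proof.
move=> ji; have [ex|nex] := pselect (exists m, `[< exists2 p, fill_path H i j p & size p = m >]).
  right; have [m /asboolP[p fp pm] minm] := ex_minnP ex.
  have m0 : (0 < m)%N.
    rewrite -pm lt0n; apply: contraTneq fp => /size0nil ->.
    by rewrite /fill_path /= andbT; apply: contraTneq ji => ->; rewrite ltnn.
  exists m.-1; split; last first.
    move=> q fq; rewrite prednK//; apply: minm; apply/asboolP; by exists q.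
  rewrite /level /d_fill (_ : ereal_inf _ = m%:R%:E).
    by rewrite -EFinB -[1]/(1%:R) -natrB// subn1; apply/max_idPr; rewrite lee_fin ler0n.
  apply/eqP; rewrite eq_le; apply/andP; split.
    by apply: ereal_inf_lbound; exists p => //; rewrite pm.
  apply: le_ereal_inf_tmp => _ [q fq <-]; rewrite lee_fin ler_nat; apply: minm.
  by apply/asboolP; exists q.
left; have fill0 p : ~~ fill_path H i j p.
  by apply/negP => fp; apply: nex; exists (size p); apply/asboolP; exists p.
split=> //; rewrite /level /d_fill [X in ereal_inf X](_ : _ = set0).
  by rewrite ereal_inf0; apply/max_idPr; rewrite leey.
by apply/seteqP; split => // _ [p /= fp _]; have := fill0 p; rewrite fp.
Qed.

Lemma decay_from_poly (R : realType) (E : set R) (z : R[i])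
    (Fam : forall n : nat, set 'M[R]_n) (a C0 : R) :
  compact E -> off E z ->
  (forall n (H : 'M[R]_n), Fam n H -> H^T = H) ->
  (exists s : nat, forall n (H : 'M[R]_n), Fam n H -> sparse_mx H s) ->
  (forall n (H : 'M[R]_n), Fam n H -> lead_spectra_in E H) ->
  0 <= C0 ->
  (forall m : nat, exists p : {poly R[i]},
     [/\ (size p <= m.+1)%N, p.[z] = 1 &
         forall x, E x -> cabs p.[x%:C] <= C0 * expR (- (a *+ m))]) ->
  exists C : R,
    forall (n : nat) (H : 'M[R]_n), Fam n H ->
    forall L D : 'M[R[i]]_n, is_LDL (cmx H - z%:M) L D ->
    forall i j : 'I_n, (j <= i)%N ->
      ((cabs (L i j))%:E <= C%:E * expeR (- (a%:E * level H i j)))%E.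
Proof.
move=> cE Ez Hsym [s Hsp] Hspec C00 key.
have [delta d0 dE] := off_dist cE Ez.
have [b b0' bE] := compact_norm_bound cE.
pose K := s%:R * (b * (C0 / delta)).
have K0 : 0 <= K by rewrite /K !mulr_ge0// invr_ge0 ltW.
(* The summand 1 covers the diagonal, where [L i i = 1] and the level is 0, and makes the constant
   positive. *)
exists (1 + K) => n H FH L D LDL i j.
rewrite leq_eqVlt => /orP[/eqP/val_inj ->|ji].
  have -> : level H i i = 0%E.
    rewrite /level; apply/max_idPl; apply: (@le_trans _ _ (0 - 1)%E).
      rewrite leeD2r//; apply: ereal_inf_lbound; exists [::] => //=.
      by rewrite /fill_path /= eqxx.
    by rewrite sub0e leeNl oppe0 lee_fin.
  have [_ -> _ _] := LDL.
  by rewrite Normc.normc1 mule0 oppe0 /= expR0 mule1 lee_fin lerDl.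
have bound m : (forall p, fill_path H i j p -> (m < size p)%N) ->
    cabs (L i j) <= K * expR (- (a *+ m)).
  move=> fm; have [q [sq qz qE]] := key m.
  have c0 : 0 <= C0 * expR (- (a *+ m)) by rewrite mulr_ge0// expR_ge0.
  apply: le_trans (LDL_decay d0 dE b0' bE sq qz c0 qE (Hsym _ _ FH) (Hsp _ _ FH)
    (Hspec _ _ FH) LDL ji fm) _.
  by rewrite le_eqVlt; apply/orP; left; apply/eqP; rewrite /K; ring.
have [[-> nop]|[m [-> fm]]] := fill_level_le H ji; last first.
  rewrite /= -EFinM lee_fin mulr_natr.
  by apply: le_trans (bound m fm) _; rewrite ler_wpM2r ?expR_ge0// lerDr.
(* Infinite level: the right-hand side is [+oo] for [a < 0]. For [a > 0] it is 0, and the bounds for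
   all [m] together force the entry to vanish. For [a = 0] the convention [0 * +oo = 0] leaves the
   bound with [m = 0]. *)
have [a0|a0|a0] := ltgtP a 0.
- by rewrite lt0_muley ?lte_fin//= gt0_muley ?lte_fin ?leey// ltr_pwDl.
- rewrite gt0_muley ?lte_fin//= mule0 lee_fin leNgt; apply/negP => L0.
  have K1 : 0 < 1 + K by rewrite ltr_pwDl.
  have [m mK] : exists m : nat, K / cabs (L i j) < expR (a *+ m).
    exists (Num.truncn (K / cabs (L i j) / a)).+1.
    apply: lt_le_trans (expR_ge1Dx _); rewrite -mulr_natl.
    by rewrite ltr_wpDl// -ltr_pdivrMr// truncnS_gt.
  have fm p : fill_path H i j p -> (m < size p)%N by move=> fp; have := nop p; rewrite fp.
  have := bound m fm; rewrite expRN leNgt ltr_pdivrMr ?expR_gt0// mulrC -ltr_pdivrMr//.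
  by rewrite mK.
- rewrite a0 mul0e oppe0 /= expR0 mule1 lee_fin.
  have := bound 0%N; rewrite mulr0n oppr0 expR0 mulr1 => /(_ _)/le_trans; apply.
    by move=> p fp; have := nop p; rewrite fp.
  by rewrite lerDr.
Qed.

(** * Fekete points *)

(** Each unordered pair occurs twice in the double product, hence the square. *)
Lemma prod_offdiag_split (R : comPzRingType) (I : finType) (f : I -> I -> R) (i : I) :
  (forall k l, f k l = f l k) ->
  \prod_k \prod_(l | l != k) f k l =
  (\prod_(l | l != i) f i l) ^+ 2 * \prod_(k | k != i) \prod_(l | (l != k) && (l != i)) f k l.
Proof.
move=> fC; rewrite (bigD1 i)//= expr2 -mulrA; congr (_ * _).
under [X in X = _]eq_bigr => k ki.
  rewrite (bigD1 i) 1?eq_sym//= fC.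
  over.
by rewrite big_split.
Qed.

(** The points maximize the product of all mutual distances. Moving only the point [i] to [t]
    changes only the factors involving [i], and the common remaining factor is positive and
    cancels. *)
Lemma fekete (R : realType) (E : set R) (n : nat) : compact E ->
  (exists2 y : 'I_n.+1 -> R, (forall i, E (y i)) & injective y) ->
  exists x : 'I_n.+1 -> R, [/\ forall i, E (x i), injective x &
    forall i t, E t ->
      \prod_(l | l != i) `|t - x l| <= \prod_(l | l != i) `|x i - x l|].
Proof.
move=> cE [y Ey y_inj].
pose A := [set v : 'rV[R]_n.+1 | forall i, E (v 0 i)].
pose V (v : 'rV[R]_n.+1) := \prod_k \prod_(l | l != k) `|v 0 k - v 0 l|.
have cA : compact A by exact: (@rV_compact _ _ (fun=> E)).
have cV : {within A, continuous V}.
  apply: continuous_subspaceT; apply: continuous_big => [|k _]; first exact: mul_continuous.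
  apply: continuous_big => [|l _ v]; first exact: mul_continuous.
  have cc j : (fun w : 'rV[R]_n.+1 => w 0 j) @ v --> v 0 j by exact: coord_continuous.
  exact: (cvg_norm (cvgB (cc k) (cc l))).
have A0 : A !=set0 by exists (\row_i y i) => i; rewrite mxE.
have [v /set_mem Av vmax] := compact_EVT_max A0 cA cV.
have V0 : 0 < V v.
  apply: (@lt_le_trans _ _ (V (\row_i y i))); last first.
    by apply: vmax; apply/mem_set => i; rewrite mxE.
  apply: prodr_gt0 => k _; apply: prodr_gt0 => l lk.
  by rewrite !mxE normr_gt0 subr_eq0 (inj_eq y_inj) eq_sym.
have v_inj : injective (v 0).
  move=> k l vkl; apply/eqP; apply: contraTT V0 => kl; rewrite /V.
  rewrite (bigD1 k)//= (bigD1 l) 1?eq_sym//= vkl subrr normr0 !mul0r ltxx//.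
exists (v 0); split => // i t Et.
pose w : 'rV[R]_n.+1 := \row_k (if k == i then t else v 0 k).
have Aw : A w by move=> k; rewrite mxE; case: ifP.
have sym (u : 'rV[R]_n.+1) k l : `|u 0 k - u 0 l| = `|u 0 l - u 0 k| by exact: distrC.
have := vmax w (mem_set Aw).
rewrite /V !(prod_offdiag_split i (sym _)).
set X := \prod_(k | k != i) \prod_(l | _) _; set Y := \prod_(k | k != i) \prod_(l | _) `|v 0 k - _|.
have -> : X = Y.
  apply: eq_bigr => k ki; apply: eq_bigr => l /andP[lk li].
  by rewrite !mxE (negPf ki) (negPf li).
have Y0 : 0 < Y.
  apply: prodr_gt0 => k _; apply: prodr_gt0 => l /andP[lk _].
  by rewrite normr_gt0 subr_eq0 (inj_eq v_inj) eq_sym.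
rewrite ler_pM2r// ler_sqr ?nnegrE ?prodr_ge0//.
rewrite (_ : \prod_(l | l != i) `|t - v 0 l| = \prod_(l | l != i) `|w 0 i - w 0 l|)//.
by apply: eq_bigr => l li; rewrite !mxE eqxx (negPf li).
Qed.

(** * Helly's selection theorem *)

Lemma near_prod_topology_seq (R : realType) (f : prod_topology (fun _ : rat => R)) (s : seq rat) (e : R) :
  0 < e -> \forall g \near f, forall q, q \in s -> `|f q - g q| < e.
Proof.
move=> e0; elim: s => [|q s IH].
  by apply: (@filterE _ (nbhs f)) => g q; rewrite in_nil.
have fq : \forall g \near f, `|f q - g q| < e.
  have pq : (fun g : prod_topology (fun _ : rat => R) => g q) @ f --> (f q : R).
    exact: (@proj_continuous rat (fun _ => R) q f).
  by move/cvgrPdist_lt : pq => /(_ e e0).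
have FF : Filter (nbhs f) by exact: nbhs_filter.
move: fq IH; apply: (@filterS2 _ _ FF) => g gq gs q'; rewrite inE => /orP[/eqP ->|].
  exact: gq.
exact: gs.
Qed.

(** Tychonoff's theorem gives a cluster point [f] in the product over the rationals. The index
    [sg k] is chosen at least [k] and such that [F (sg k)] is within [1 / (k + 1)] of [f] at the
    rationals with code less than [k]; [sg] need not be increasing. *)
Lemma diagonal_extraction (R : realType) (b : R) (F : nat -> rat -> R) :
  (forall n q, `|F n q| <= b) ->
  exists (sg : nat -> nat) (f : rat -> R),
    (forall k, (k <= sg k)%N) /\ forall q, F (sg k) q @[k --> \oo] --> f q.
Proof.
move=> Fb.
have cA := @tychonoff rat (fun _ => R) (fun _ => `[-b, b]%classic) (fun _ => @segment_compact _ _ _).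
pose G n : prod_topology (fun _ : rat => R) := F n.
have FA : (G @ \oo) [set f : forall i : rat, R | forall i, `[-b, b]%classic (f i)].
  rewrite /nbhs /= /fmap /=; apply: (@nearW nat \oo) => n q /=.
  by rewrite in_itv /= -ler_norml.
have PF : ProperFilter (G @ \oo).
  exact: fmap_proper_filter.
have [f [_ clf]] := cA _ PF FA.
have step k : exists n, (k <= n)%N /\
    forall q, q \in pmap (@unpickle rat) (iota 0 k) -> `|f q - F n q| < k.+1%:R^-1.
  have k0 : 0 < k.+1%:R^-1 :> R by rewrite invr_gt0.
  have Fk : (G @ \oo) [set G n | n in [set n | (k <= n)%N]].
    by apply: (filterS _ (nbhs_infty_ge k)) => n /= kn; exists n.
  have [_ [[n kn <-] h]] := clf _ _ Fk (near_prod_topology_seq f (pmap (@unpickle rat) (iota 0 k)) k0).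
  by exists n.
have [sg sgP] := choice step.
exists sg, f; split=> [k|q]; first by have [] := sgP k.
apply/cvgrPdist_lt => e e0; near=> k.
apply: (@lt_trans _ _ k.+1%:R^-1).
  have [_] := sgP k; apply; rewrite mem_pmap; apply/mapP; exists (pickle q).
    by rewrite mem_iota add0n /=; near: k; exists (pickle q).+1.
  by rewrite pickleK.
near: k; exact: near_infty_natSinv_lt (PosNum e0).
Unshelve. all: by end_near. Qed.

Lemma rat_between (R : realType) (x y : R) : x < y -> exists q : rat, x < ratr q < y.
Proof.
by move=> /rat_in_itvoo[q]; rewrite in_itv /=; exists q.
Qed.

(** [Q] and [Q'] are the left and right limits at [s] of the limit function on the rationals. Where
    they agree, values at rationals on both sides of [s] squeeze [F (sg k) s]; where they differ
    there is a jump. *)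
Lemma helly (R : realType) (b : R) (F : nat -> R -> R) :
  (forall n, nondecreasing_fun (F n)) -> (forall n s, `|F n s| <= b) ->
  exists (sg : nat -> nat) (Q : R -> R) (S : set R),
    [/\ forall k, (k <= sg k)%N, nondecreasing_fun Q, countable S &
        forall s, ~ S s -> F (sg k) s @[k --> \oo] --> Q s].
Proof.
move=> Fnd Fb.
have [sg [f [sgk Ff]]] := @diagonal_extraction R b (fun n q => F n (ratr q))
  (fun n q => Fb n (ratr q)).
have f_nd p q : p <= q -> f p <= f q.
  move=> pq; apply: (ler_cvg_to (Ff p) (Ff q)).
  by apply: nearW => k; apply: Fnd; rewrite ler_rat.
have fb q : `|f q| <= b.
  by apply: (cvgr_to_le (cvg_norm (Ff q))); apply: nearW => k; exact: Fb.
pose A (s : R) := [set f q | q in [set q : rat | ratr q < s]].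
pose B (s : R) := [set f q | q in [set q : rat | s < ratr q]].
pose Q s := sup (A s); pose Q' s := inf (B s).
have A_sup s : has_sup (A s).
  split; last by exists b => _ [q _ <-]; apply: le_trans (ler_norm _) (fb q).
  have [q /andP[_ qs]] := @rat_between R (s - 1) s ltac:(by rewrite ltrBlDr ltrDl).
  by exists (f q); exists q.
have B_inf s : has_inf (B s).
  split; last by exists (- b) => _ [q _ <-]; have := fb q; rewrite ler_norml => /andP[].
  have [q /andP[sq _]] := @rat_between R s (s + 1) ltac:(by rewrite ltrDl).
  by exists (f q); exists q.
have QQ' s : Q s <= Q' s.
  apply: ge_sup; first by have [] := A_sup s.
  move=> _ [p ps <-]; apply: lb_le_inf; first by have [] := B_inf s.
  move=> _ [q sq <-]; apply: f_nd; rewrite -(ler_rat R); apply: ltW; exact: lt_trans ps sq.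
have fQ q s : ratr q < s -> f q <= Q s.
  by move=> qs; apply: ub_le_sup; [have [] := A_sup s|exists q].
have Q'f q s : s < ratr q -> Q' s <= f q.
  by move=> qs; apply: ge_inf; [have [] := B_inf s|exists q].
exists sg, Q, [set s | Q s < Q' s]; split => //.
- move=> s t st; apply: ge_sup; first by have [] := A_sup s.
  by move=> _ [p ps <-]; apply: fQ; apply: lt_le_trans ps st.
(* A rational chosen inside each jump determines the jump, since distinct jumps are disjoint
   intervals of values. *)
- have /choice[r rP] : forall s, exists q : rat, Q s < Q' s -> Q s < ratr q < Q' s.
    move=> s; have [/rat_between[q qs]|] := ltP (Q s) (Q' s); first by exists q.
    by exists 0.
  apply/pcard_injP; exists (pickle \o r) => s t /[!inE] /= Ss St /(pcan_inj pickleK) rst.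
  have lt_r u v : Q u < Q' u -> Q v < Q' v -> u < v -> r u != r v.
    move=> Su Sv uv; apply/eqP => ruv.
    have [q /andP[uq qv]] := rat_between uv.
    have /andP[_ ru] := rP _ Su; have /andP[rv _] := rP _ Sv.
    have := lt_le_trans (lt_le_trans ru (Q'f _ _ uq)) (fQ _ _ qv).
    by rewrite ruv => /lt_trans/(_ rv); rewrite ltxx.
  have [st|st|//] := ltgtP s t.
    by have := lt_r _ _ Ss St st; rewrite rst eqxx.
  by have := lt_r _ _ St Ss st; rewrite rst eqxx.
- move=> s /negP; rewrite -leNgt => Q'Q.
  apply/cvgrPdist_lt => e e0.
  have [_ [p /= ps <-] pe] := sup_adherent e0 (A_sup s).
  have [_ [q /= sq <-] qe] := inf_adherent e0 (B_inf s).
  have Qe : Q s = Q' s by apply/eqP; rewrite eq_le QQ' Q'Q.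
  have pe' : Q s - f p < e by rewrite ltrBlDl -ltrBlDr.
  have qe' : f q - Q s < e by rewrite ltrBlDl Qe.
  have ep0 : 0 < e - (Q s - f p) by rewrite subr_gt0.
  have eq0 : 0 < e - (f q - Q s) by rewrite subr_gt0.
  near=> k.
  have np : `|f p - F (sg k) (ratr p)| < e - (Q s - f p).
    by near: k; have /cvgrPdist_lt := Ff p; exact.
  have nq : `|f q - F (sg k) (ratr q)| < e - (f q - Q s).
    by near: k; have /cvgrPdist_lt := Ff q; exact.
  have Fp := Fnd (sg k) _ _ (ltW ps); have Fq := Fnd (sg k) _ _ (ltW sq).
  by move: np nq; rewrite !ltr_norml => /andP[? ?] /andP[? ?]; apply/andP; split; lra.
Unshelve. all: by end_near. Qed.

(** * Polar compact sets and small monic polynomials *)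

(** The positive part of the logarithmic kernel, equal to [+oo] on the diagonal. Nonnegativity gives
    access to Fatou's lemma. *)
Definition log_kernel (R : realType) (x y : R) : \bar R := maxe 0%E (- lne `|x - y|%:E)%E.

(* Vanishes on the diagonal, because [ln 0 = 0]. *)
Definition log_kernel_off (R : realType) (x y : R) : R := Num.max 0 (- ln `|x - y|).

Lemma log_kernel_ge0 (R : realType) (x y : R) : (0 <= log_kernel x y)%E.
Proof. by rewrite /log_kernel le_max lexx. Qed.

Lemma log_kernel_off_ge0 (R : realType) (x y : R) : 0 <= log_kernel_off x y.
Proof. by rewrite /log_kernel_off le_max lexx. Qed.

Lemma log_kernelE (R : realType) (x y : R) : x != y -> log_kernel x y = (log_kernel_off x y)%:E.
Proof.
by move=> xy; rewrite /log_kernel lne_EFin ?normr_gt0 ?subr_eq0// /log_kernel_off EFin_max.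
Qed.

Lemma measurable_log_kernel (R : realType) (x : R) :
  measurable_fun [set: R] (log_kernel x).
Proof.
apply: measurable_maxe => //; apply: measurableT_comp => //.
have mN : measurable_fun [set: R] (fun y : R => `|x - y|).
  by apply: measurableT_comp => //; exact: measurable_funB.
apply: measurable_fun_ifT => //.
  exact: measurable_fun_ler.
by apply/measurable_EFinP; apply: measurableT_comp => //; exact: measurable_ln.
Qed.

(** Semicontinuity of the kernel along sequences. The terms must be distinct because
    [log_kernel_off] is 0 on the diagonal, whereas distinct points that merge send it to [+oo]. *)
Lemma log_kernel_le_limn_einf (R : realType) (u v : nat -> R) (x y : R) :
  u k @[k --> \oo] --> x -> v k @[k --> \oo] --> y ->
  (\forall k \near \oo, u k != v k) ->
  (log_kernel x y <= limn_einf (fun k => (log_kernel_off (u k) (v k))%:E))%E.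
Proof.
move=> ux vy uv.
have duv : `|u k - v k| @[k --> \oo] --> `|x - y| by exact: (cvg_norm (cvgB ux vy)).
have [xy|xy] := eqVneq x y; last first.
  have xy0 : 0 < `|x - y| by rewrite normr_gt0 subr_eq0.
  have lim : (log_kernel_off (u k) (v k))%:E @[k --> \oo] --> log_kernel x y.
    rewrite log_kernelE//; apply: cvg_EFin; first exact: nearW.
    have cH : {for `|x - y|, continuous ((fun _ : R => 0) \max (fun t : R => - ln t))}.
      apply: continuous_max; first exact: cst_continuous.
      by apply: continuousN; exact: continuous_ln.
    exact: (continuous_cvg _ cH duv).
  by rewrite (cvg_limn_einf_sup lim).1.
suff lim : (log_kernel_off (u k) (v k))%:E @[k --> \oo] --> +oo%E.
  by rewrite (cvg_limn_einf_sup lim).1 leey.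
apply/cvgeyPge => A.
rewrite xy subrr normr0 in duv.
near=> k; rewrite lee_fin /log_kernel_off le_max; apply/orP; right.
have d0 : 0 < `|u k - v k| by rewrite normr_gt0 subr_eq0; near: k.
rewrite lerNr -[leRHS]expRK ler_ln ?posrE ?expR_gt0//.
rewrite -[leLHS]normr_id.
near: k; have /cvgr0_norm_le := duv; apply; exact: expR_gt0.
Unshelve. all: by end_near. Qed.

(** * Step functions on a division of [0, 1[ into equal cells *)

Definition cell (R : realType) (n i : nat) : set R :=
  `[i%:R / n.+1%:R, i.+1%:R / n.+1%:R[%classic.
Arguments cell : clear implicits.

Lemma measurable_cell (R : realType) n i : measurable (cell R n i).
Proof. exact: measurable_itv. Qed.

Lemma uniform_cell (R : realType) n i : (i <= n)%N ->
  uniform_prob (@ltr01 R) (cell R n i) = (n.+1%:R^-1)%:E.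
Proof.
move=> ile.
transitivity (\int[uniform_prob (@ltr01 R)]_x (\1_(cell R n i) x)%:E)%E.
  by rewrite integral_indic ?setIT//; exact: (@measurable_cell R n i).
rewrite integral_uniform//; last first.
  by apply/measurable_EFinP; apply: measurable_indic; exact: (@measurable_cell R n i).
rewrite subr0 invr1 mul1e integral_indic//; last exact: (@measurable_cell R n i).
have n0 : 0 < n.+1%:R :> R by [].
rewrite (_ : _ `&` _ = cell R n i); last first.
  apply/setIidl => x; rewrite /cell /= !in_itv /= => /andP[x1 x2].
  apply/andP; split; first by apply: le_trans x1; rewrite divr_ge0.
  by apply: le_trans (ltW x2) _; rewrite ler_pdivrMr// mul1r ler_nat.
rewrite /cell /= lebesgue_measure_itv /= lte_fin ltr_pM2r ?invr_gt0// ltr_nat ltnSn.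
by rewrite -EFinB -mulrBl -natrB// subSnn mul1r.
Qed.

(** The cap at [n] gives a valid index for every real [s], so that a family of points indexed up to
    [n] yields a function on the whole line, monotone when the family is. *)
Definition cell_index (R : realType) (n : nat) (s : R) : nat :=
  minn (Num.truncn (n.+1%:R * s)) n.

Lemma cell_index_le (R : realType) n (s : R) : (cell_index n s <= n)%N.
Proof. exact: geq_minr. Qed.

Lemma cell_indexE (R : realType) n i (s : R) : (i <= n)%N -> cell R n i s -> cell_index n s = i.
Proof.
move=> ile; rewrite /cell /= in_itv /= => /andP[s1 s2].
rewrite /cell_index (@truncn_def _ _ i); first exact/minn_idPl.
by rewrite mulrC -ler_pdivrMr// s1 -ltr_pdivlMr.
Qed.

Lemma mem_cell_index (R : realType) n (s : R) : 0 <= s < 1 -> cell R n (cell_index n s) s.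
Proof.
move=> /andP[s0 s1]; have ns0 : 0 <= n.+1%:R * s by rewrite mulr_ge0.
have lt_n : (Num.truncn (n.+1%:R * s) <= n)%N.
  by rewrite -ltnS truncn_lt_nat// gtr_pMr.
rewrite /cell_index (minn_idPl lt_n) /cell /= in_itv /= ler_pdivrMr// ltr_pdivlMr//.
by rewrite [s * _]mulrC truncn_itv.
Qed.

Lemma cell_index_mono (R : realType) n (s t : R) : s <= t -> (cell_index n s <= cell_index n t)%N.
Proof.
move=> st; rewrite /cell_index leq_min geq_minr andbT.
by apply: leq_trans (geq_minl _ _) _; rewrite le_truncn// ler_pM2l.
Qed.

Lemma cell_index_sep (R : realType) (s t : R) : 0 <= s -> t < 1 -> s < t ->
  \forall n \near \oo, (cell_index n s < cell_index n t)%N.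
Proof.
move=> s0 t1 st; have ts0 : 0 < t - s by rewrite subr_gt0.
near=> n.
have t0 : 0 <= t by rewrite (le_trans s0)// ltW.
have lt_n (u : R) : 0 <= u -> u < 1 -> (Num.truncn (n.+1%:R * u) <= n)%N.
  by move=> u0 u1; rewrite -ltnS truncn_lt_nat ?mulr_ge0// gtr_pMr.
rewrite /cell_index (minn_idPl (lt_n _ s0 (lt_trans st t1))) (minn_idPl (lt_n _ t0 t1)).
rewrite truncn_ge_nat ?mulr_ge0//.
have : (Num.truncn (n.+1%:R * s))%:R <= n.+1%:R * s by rewrite truncn_le mulr_ge0.
(* Once a cell is no longer than [t - s], the scaled points differ by at least 1, hence so do their
   integer parts. *)
have : 1 <= n.+1%:R * (t - s).
  rewrite -ler_pdivrMr// div1r; apply: ltW; apply: lt_le_trans (truncnS_gt _) _.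
  by rewrite ler_nat ltnS; near: n; exact: nbhs_infty_ge.
rewrite mulrBr -[in X in _ -> _ -> X]natr1; move: (n.+1%:R * s) (n.+1%:R * t) => u v; lra.
Unshelve. all: by end_near. Qed.

Definition step_fun (R : realType) n (F : nat -> R) (t : R) : R :=
  \sum_(i < n.+1) F i * \1_(cell R n i) t.

Lemma step_funE (R : realType) n (F : nat -> R) (t : R) : 0 <= t < 1 ->
  step_fun n F t = F (cell_index n t).
Proof.
move=> t01; have ti := mem_cell_index n t01; have ile := cell_index_le n t.
rewrite /step_fun (bigD1 (Ordinal (ile : (cell_index n t < n.+1)%N)))//= big1 ?addr0.
  by rewrite indicE mem_set// mulr1.
move=> i iN; rewrite indicE memNset ?mulr0// => ci.
have ti' : cell_index n t = i by apply: cell_indexE ci; rewrite -ltnS.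
by move/eqP: iN; apply; apply: val_inj; rewrite /= ti'.
Qed.

Lemma measurable_step_fun (R : realType) n (F : nat -> R) : measurable_fun [set: R] (step_fun n F).
Proof.
apply: measurable_sum => i; apply: measurable_funM => //.
by apply: measurable_indic; exact: (@measurable_cell R n i).
Qed.

Lemma integral_step_fun (R : realType) n (F : nat -> R) : (forall i, 0 <= F i) ->
  (\int[uniform_prob (@ltr01 R)]_t (step_fun n F t)%:E = ((\sum_(i < n.+1) F i) / n.+1%:R)%:E)%E.
Proof.
move=> F0.
under eq_integral do rewrite /step_fun -sumEFin.
rewrite ge0_integral_sum//.
- rewrite big_distrl/= -sumEFin; apply: eq_bigr => i _.
  under eq_integral do rewrite EFinM.
  rewrite ge0_integralZl//=.
  + rewrite integral_indic ?setIT//; last exact: (@measurable_cell R n i).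
    by rewrite EFinM; congr (_ * _)%E; apply: uniform_cell; rewrite -ltnS.
  + by apply/measurable_EFinP; apply: measurable_indic; exact: (@measurable_cell R n i).
  + by rewrite lee_fin.
- move=> i; apply/measurable_EFinP; apply: measurable_funM => //.
  by apply: measurable_indic; exact: (@measurable_cell R n i).
- by move=> i t _; rewrite lee_fin mulr_ge0.
Qed.

Lemma limn_einf_le (R : realType) (u : nat -> \bar R) (M : \bar R) :
  (forall k, u k <= M)%E -> (limn_einf u <= M)%E.
Proof.
move=> uM; rewrite limn_einf_lim; apply: lime_le; first exact: is_cvg_einfs.
by apply: nearW => k; apply: le_trans (uM k); apply: ereal_inf_lbound; exists k => /=.
Qed.

Lemma le_limn_einf (R : realType) (u : nat -> \bar R) (M : \bar R) :
  (forall k, M <= u k)%E -> (M <= limn_einf u)%E.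
Proof.
move=> uM; rewrite limn_einf_lim; apply: lime_ge; first exact: is_cvg_einfs.
by apply: nearW => k; apply: le_ereal_inf_tmp => _ [j _ <-].
Qed.

Lemma uniform_prob_null (R : realType) (A : set R) : countable A ->
  uniform_prob (@ltr01 R) (A `|` ~` `[0, 1[) = 0%E /\ measurable (A `|` ~` `[0, 1[).
Proof.
move=> cA.
have mA : measurable A by apply: countable_measurable => // x.
have mI : measurable (~` `[0 : R, 1[%classic) by apply: measurableC; exact: measurable_itv.
split; last exact: measurableU.
apply/eqP; rewrite eq_le measure_ge0 andbT.
apply: le_trans (measureU2 _ _ _) _ => //.
rewrite [X in (X + _)%E](_ : _ = 0%E); last first.
  have := @dominates_uniform_prob R _ _ (@ltr01 R).
  move=> /null_content_dominatesP; apply => //; exact: countable_lebesgue_measure0.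
rewrite add0e.
(* For [n = 0] the only cell is [0, 1[ itself, of probability 1. *)
have := @uniform_cell R 0 0 isT; rewrite /cell mul0r divr1 invr1 => P1.
have mI01 : measurable `[0 : R, 1[%classic by exact: measurable_itv.
rewrite [leLHS](_ : _ = (1 - 1)%E) ?subee//.
apply: etrans (probability_setC (uniform_prob (@ltr01 R)) mI01) _.
by apply: etrans (congr1 (fun x : \bar R => 1 - x)%E P1) _; rewrite subee.
Qed.

(** Divided by the number of points, the discrete potential is the integral of a step function in
    [t]. Fatou's lemma passes the bound [M] to the limit. *)
Lemma potential_le (R : realType) (nn : nat -> nat) (y : nat -> nat -> R) (S : set R)
    (Q : R -> R) (M : R) (s : R) :
  (forall k, (k <= nn k)%N) ->
  (forall k i j, (i <= nn k)%N -> (j <= nn k)%N -> y k i = y k j -> i = j) ->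
  (forall k i, (i <= nn k)%N ->
    \sum_(j < (nn k).+1) log_kernel_off (y k i) (y k j) <= M * (nn k).+1%:R) ->
  measurable_fun [set: R] Q ->
  countable S ->
  (forall t, ~ S t -> y k (cell_index (nn k) t) @[k --> \oo] --> Q t) ->
  ~ S s -> 0 <= s < 1 ->
  (\int[uniform_prob (@ltr01 R)]_t log_kernel (Q s) (Q t) <= M%:E)%E.
Proof.
move=> nnk y_inj yM mQ cS yQ Ss s01.
pose a k := y k (cell_index (nn k) s).
pose F k j := log_kernel_off (a k) (y k j).
pose f k t := (step_fun (nn k) (F k) t)%:E.
have F0 k j : 0 <= F k j by exact: log_kernel_off_ge0.
have mf k : measurable_fun [set: R] (f k).
  by apply/measurable_EFinP; exact: measurable_step_fun.
have f0 k t : [set: R] t -> (0 <= f k t)%E.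
  by move=> _; rewrite lee_fin /f /step_fun sumr_ge0// => i _; rewrite mulr_ge0.
have fat := fatou (uniform_prob (@ltr01 R)) measurableT mf f0.
have fM : (limn_einf (fun k => \int[uniform_prob (@ltr01 R)]_t f k t) <= M%:E)%E.
  apply: limn_einf_le => k; rewrite integral_step_fun// lee_fin.
  by rewrite ler_pdivrMr//; apply: yM; exact: cell_index_le.
apply: le_trans (le_trans fat fM).
(* The point [s] is discarded as well: only for [t != s] do the cells of [s] and [t] eventually
   differ. *)
have cS1 : countable (S `|` [set s]).
  rewrite -bigcup2E; apply: bigcup_countable; first exact: countableP.
  by move=> [|[|i]] _ //=.
have [N0 mN] := uniform_prob_null cS1.
apply: ae_ge0_le_integral => //.
- by move=> t _; exact: log_kernel_ge0.
- exact: measurableT_comp (measurable_log_kernel (Q s)) mQ.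
- by move=> t _; apply: le_limn_einf => k; exact: f0.
- apply: measurableT_comp => //; apply: measurable_fun_limn_esup => k.
  have mo : measurable_fun [set: \bar R] (-%E : \bar R -> \bar R) by [].
  exact: (measurableT_comp mo (mf k)).
exists ((S `|` [set s]) `|` ~` `[0, 1[); split => // t.
apply: contra_notP => /not_orP[/not_orP[St ts] /contrapT].
rewrite /= in_itv /= => t01 _.
apply: (@le_trans _ _ (limn_einf (fun k => (log_kernel_off (a k) (y k (cell_index (nn k) t)))%:E))).
  apply: log_kernel_le_limn_einf; [exact: yQ|exact: yQ|].
  have sep : \forall n \near \oo, cell_index n s != cell_index n t.
    move/eqP/lt_total : ts; move: s01 t01 => /andP[s0 s1] /andP[t0 t1] /orP[ts|st].
      by apply: filterS (cell_index_sep t0 s1 ts) => n; rewrite neq_ltn orbC => ->.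
    by apply: filterS (cell_index_sep s0 t1 st) => n; rewrite neq_ltn => ->.
  have [K _ sepK] := sep; exists K => // k Kk /=; apply: contraNneq (sepK _ (leq_trans Kk (nnk k))).
  by move=> /y_inj ->//; exact: cell_index_le.
rewrite le_eqVlt; apply/orP; left; apply/eqP; congr limn_einf.
by apply/funext => k; rewrite /f step_funE.
Qed.

(** [f] will be a potential whose measurability is not established. The change of variables is
    therefore applied to the simple functions below [f], of whose integrals the integral of [f] is
    the supremum. *)
Lemma integral_le_of_ae_le (R : realType) d (T : measurableType d) (P : probability T R)
    (Q : T -> R) (f : R -> \bar R) (M : R) (N : set T) (mQ : measurable_fun [set: T] Q) :
  measurable N -> P N = 0%E -> 0 <= M -> (forall x, 0 <= f x)%E ->
  (forall s, ~ N s -> (f (Q s) <= M%:E)%E) ->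
  (\int[distribution P (mfun_Sub (mem_set mQ))]_x f x <= M%:E)%E.
Proof.
move=> mN PN M0 f0 fM; rewrite ge0_integralTE//.
apply: ge_ereal_sup => _ [h hf <-].
rewrite -integralT_nnsfun ge0_integral_distribution//; last 2 first.
  by apply/measurable_EFinP.
  by move=> x; rewrite lee_fin.
apply: (@le_trans _ _ (\int[P]_x M%:E)%E); last first.
  rewrite integral_cst// [X in (_ * X)%E](_ : _ = 1%E) ?mule1//.
  exact: probability_setT.
apply: ae_ge0_le_integral => //.
- by move=> x _; rewrite lee_fin.
- apply/measurable_EFinP; apply: measurableT_comp => //.
exists N; split => // s; apply: contra_notP => Ns _ /=.
by apply: le_trans (fM _ Ns); exact: hf.
Qed.

(** The measure is the law of [Q] under the uniform probability. Its potential is at most [M] at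
    [Q s] for almost every [s], and integrating once more bounds the energy. *)
Lemma log_energy_finite (R : realType) (K S : set R) (nn : nat -> nat) (y : nat -> nat -> R)
    (Q : R -> R) (M : R) :
  compact K ->
  (forall k, (k <= nn k)%N) ->
  (forall k i, (i <= nn k)%N -> K (y k i)) ->
  (forall k i j, (i <= nn k)%N -> (j <= nn k)%N -> y k i = y k j -> i = j) ->
  (forall k i, (i <= nn k)%N ->
    \sum_(j < (nn k).+1) log_kernel_off (y k i) (y k j) <= M * (nn k).+1%:R) ->
  nondecreasing_fun Q -> countable S ->
  (forall t, ~ S t -> y k (cell_index (nn k) t) @[k --> \oo] --> Q t) ->
  exists mu : probability R R, mu (~` K) = 0%E /\ log_energy mu <> +oo%E.
Proof.
move=> cK nnk yK y_inj yM ndQ cS yQ.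
have mQ : measurable_fun [set: R] Q by exact: nondecreasing_measurable.
have clK : closed K by apply: compact_closed => //; exact: Rhausdorff.
have [N0 mN] := uniform_prob_null cS.
pose T : measurableType _ := g_sigma_algebraType R.-ocitv.-measurable.
have mQ' : measurable_fun [set: T] (Q : T -> R) by exact: mQ.
pose mu : probability R R := distribution (uniform_prob (@ltr01 R)) (@mfun_Sub _ _ T R Q (mem_set mQ')).
exists mu; split.
  apply/eqP; rewrite eq_le measure_ge0 andbT -N0.
  have mQK : measurable (Q @^-1` (~` K)).
    rewrite -[X in measurable X]setTI; apply: mQ => //.
    by apply: open_measurable; exact: closed_openC.
  apply: (le_measure (uniform_prob (@ltr01 R)) (mem_set mQK) (mem_set mN)).
  move=> s /= KQ; left; apply: contrapT => Ss; apply: KQ.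
  apply: (closed_cvg _ clK _ _ (yQ _ Ss)); apply: nearW => k.
  by apply: yK; exact: cell_index_le.
have M0 : 0 <= M.
  have := yM 0%N 0%N (leq0n _); rewrite -(@pmulr_lge0 _ (nn 0%N).+1%:R)//; apply: le_trans.
  by apply: sumr_ge0 => j _; exact: log_kernel_off_ge0.
suff le_M : (log_energy mu <= M%:E)%E by move=> muy; rewrite muy in le_M.
rewrite /log_energy integralE.
(* The integral is that of the positive part minus that of the negative part; dropping the latter
   can only increase it. The inner integral is treated in the same way below. *)
apply: (@le_trans _ _ (\int[mu]_x ((fun x => \int[mu]_y - lne `|x - y|%:E)^\+ x))%E).
  by apply: geeDl; rewrite oppe_le0; apply: integral_ge0 => x _; exact: funeneg_ge0.
apply: (@integral_le_of_ae_le R _ T (uniform_prob (@ltr01 R)) Q _ M _ mQ' mN N0) => //.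
move=> s Ns.
have pot : (\int[mu]_y log_kernel (Q s) y <= M%:E)%E.
  rewrite ge0_integral_distribution; last 2 first.
    exact: measurable_log_kernel.
    by move=> y'; exact: log_kernel_ge0.
  apply: (potential_le nnk y_inj yM mQ cS yQ).
    by move=> Ss; apply: Ns; left.
  by apply: contrapT => s01; apply: Ns; right; rewrite /= in_itv.
rewrite funeposE ge_max lee_fin M0 andbT integralE.
apply: le_trans pot.
apply: (@le_trans _ _ (\int[mu]_y ((fun y => - lne `|Q s - y|%:E)^\+ y))%E).
  by apply: geeDl; rewrite oppe_le0; apply: integral_ge0 => x _; exact: funeneg_ge0.
by under eq_integral do rewrite funeposE maxC.
Qed.

(** * Monic polynomials whose roots are Fekete points *)

Definition others (R : realType) (n : nat) (x : 'I_n.+1 -> R) (i : 'I_n.+1) : seq R :=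
  [seq x l | l <- enum 'I_n.+1 & l != i].

Lemma size_others (R : realType) (n : nat) (x : 'I_n.+1 -> R) (i : 'I_n.+1) :
  size (others x i) = n.
Proof.
have := count_predC (pred1 i) (enum 'I_n.+1).
rewrite count_uniq_mem ?enum_uniq// mem_enum size_enum_ord => -[cn].
by rewrite size_map size_filter -[RHS]cn.
Qed.

Lemma mem_others (R : realType) (E : set R) n (x : 'I_n.+1 -> R) i : (forall l, E (x l)) ->
  forall t, t \in others x i -> E t.
Proof. by move=> xE t /mapP[l _ ->]. Qed.

Lemma prod_others (R : realType) n (x : 'I_n.+1 -> R) (i : 'I_n.+1) (t : R) :
  \prod_(s <- others x i) `|t - s| = \prod_(l | l != i) `|t - x l|.
Proof. by rewrite big_map big_filter big_enum_cond. Qed.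

(** [B] is the smallest logarithm of a Lagrange denominator, attained at [i]. It bounds the
    polynomial without the root [i] from above on [E], and all denominators from below. *)
Lemma fekete_log (R : realType) (E : set R) (n : nat) : compact E -> infinite_set E ->
  exists (x : 'I_n.+1 -> R) (B : R),
    [/\ forall i, E (x i), injective x,
        forall k, B <= \sum_(l | l != k) ln `|x k - x l| &
        exists i, forall t, E t -> \prod_(l | l != i) `|t - x l| <= expR B].
Proof.
move=> cE /infiniteP/pcard_leP/injfunPex[/= f fE finj].
have [|x [xE xinj xmax]] := @fekete R E n cE.
  exists (fun i : 'I_n.+1 => f i); first by move=> i; exact: fE.
  by move=> i j /finj; rewrite !inE => /(_ I I)/val_inj.
pose S (i : 'I_n.+1) := \sum_(l | l != i) ln `|x i - x l|.
exists x, (S [arg min_(i < ord0) S i]%O).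
case: arg_minP => // i _ imin; split => //; first by move=> k; exact: imin.
exists i => t /(xmax i); rewrite /S expR_sum => /le_trans; apply.
rewrite le_eqVlt; apply/orP; left; apply/eqP; apply: eq_bigr => l li.
by rewrite lnK// posrE normr_gt0 subr_eq0 (inj_eq xinj) eq_sym.
Qed.

Lemma log_kernel_off_le (R : realType) (D x y : R) : 1 <= D -> `|x - y| <= D ->
  log_kernel_off x y <= ln D - ln `|x - y|.
Proof.
move=> D1 xyD; have [->|xy] := eqVneq x y.
  by rewrite /log_kernel_off subrr normr0 ln0// oppr0 addr0 maxxx ln_ge0.
have xy0 : 0 < `|x - y| by rewrite normr_gt0 subr_eq0.
rewrite /log_kernel_off ge_max lerDr ln_ge0// andbT.
by rewrite subr_ge0 ler_ln// posrE (lt_le_trans xy0).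
Qed.

(** For finite [K] the product over all its points vanishes on [K]. Otherwise, if no [T] exists,
    Fekete points have uniformly bounded discrete potentials and their limit contradicts the
    infinite energies. *)
Lemma polar_small_poly (R : realType) (K : set R) (M : R) : compact K ->
  (forall mu : probability R R, mu (~` K) = 0%E -> log_energy mu = +oo%E) ->
  exists T : seq R, [/\ forall t, t \in T -> K t, K !=set0 -> T != [::] &
    forall x, K x -> \prod_(t <- T) `|x - t| <= expR (- (M *+ size T))].
Proof.
move=> cK Kpolar; have [finK|infK] := pselect (finite_set K).
  have /finite_seqP[T KE] := finK; exists T; split.
  - by move=> t tT; rewrite KE.
  - by move=> [x]; rewrite KE /=; case: (T).
  - move=> x; rewrite KE /= => xT; rewrite (big_rem x)//= subrr normr0 mul0r.
    exact: expR_ge0.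
apply: contrapT => nT.
have [b b0 Kb] := compact_norm_bound cK; pose D := b + b + 1.
have D1 : 1 <= D by rewrite /D lerDr addr_ge0.
have KD' x y : K x -> K y -> `|x - y| <= D.
  move=> Kx Ky; apply: le_trans (ler_normB _ _) _.
  by rewrite /D -[leLHS]addr0 lerD// lerD// Kb.
(* [ln D] pays for the truncation of the kernel at 0, as all distances in [K] are at most [D]. *)
pose M' := `|M| + ln D.
have M'0 : 0 <= M' by rewrite addr_ge0// ln_ge0.
have lnD0 : 0 <= ln D by rewrite ln_ge0.
have pts n : exists y : nat -> R,
   [/\ forall i, (i <= n)%N -> K (y i),
       forall i j, (i <= j)%N -> (j <= n)%N -> y i <= y j,
       forall i j, (i <= n)%N -> (j <= n)%N -> y i = y j -> i = j &
       forall i, (i <= n)%N -> \sum_(j < n.+1) log_kernel_off (y i) (y j) <= M' * n.+1%:R].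
  have [x [B [xK xinj xB [i xiB]]]] := fekete_log n cK infK.
  have MB : - (M *+ n) <= B.
    (* For [n = 0] the omitted point leaves the empty list, which [nT] does not exclude; there the
       empty product gives [1 <= expR B] directly. *)
    have [n0|n0] := posnP n.
      have := xiB _ (xK i); rewrite big1 => [|l].
        by rewrite -[1]expR0 ler_expR n0 mulr0n oppr0.
      apply: contraNeq => _; apply/eqP/val_inj => /=.
      have i0 (k : 'I_n.+1) : k = 0%N :> nat by have := ltn_ord k; rewrite ltnS {2}n0 leqn0 => /eqP.
      by rewrite (i0 l) (i0 i).
    rewrite leNgt; apply/negP => BM; apply: nT.
    exists (others x i); split.
    - exact: mem_others.
    - by move=> _; rewrite -size_eq0 size_others -lt0n.
    - by move=> t Kt; rewrite size_others prod_others (le_trans (xiB t Kt))// ler_expR ltW.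
  (* Sorting makes the associated functions of the cell index monotone, as Helly's theorem
     requires. *)
  pose s := sort <=%R [seq x l | l <- enum 'I_n.+1].
  have szs : size s = n.+1 by rewrite size_sort size_map size_enum_ord.
  have us : uniq s by rewrite sort_uniq map_inj_uniq ?enum_uniq.
  have sx j : (j <= n)%N -> exists l, nth 0 s j = x l.
    move=> jn; have : nth 0 s j \in s by rewrite mem_nth// szs.
    by rewrite mem_sort => /mapP[l _ ->]; exists l.
  exists (nth 0 s); split.
  - by move=> j /sx[l ->].
  - move=> j k jk kn; apply: sorted_leq_nth => //; rewrite ?inE ?szs//.
    + exact: le_trans.
    + exact: sort_le_sorted.
    + by rewrite ltnS (leq_trans jk).
  - by move=> j k jn kn /eqP; rewrite nth_uniq ?szs// => /eqP.
  - move=> j /sx[a ->].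
    have -> : \sum_(k < n.+1) log_kernel_off (x a) (nth 0 s k) =
              \sum_l log_kernel_off (x a) (x l).
      rewrite -[in LHS]szs -(big_mkord xpredT (fun k => log_kernel_off (x a) (nth 0 s k))).
      rewrite -(big_nth 0 xpredT (log_kernel_off (x a))).
      by rewrite (perm_big _ (permEl (perm_sort _ _))) big_map big_enum.
    rewrite (bigD1 a)//= {1}/log_kernel_off subrr normr0 ln0// oppr0 maxxx add0r.
    apply: (@le_trans _ _ (\sum_(l | l != a) (ln D - ln `|x a - x l|))).
      by apply: ler_sum => l _; apply: log_kernel_off_le => //; exact: KD'.
    rewrite sumrB sumr_const.
    have -> : #|[pred l : 'I_n.+1 | l != a]| = n.
      by rewrite cardC1 card_ord.
    have := xB a; rewrite /M' -(mulr_natr (ln D)) -natr1.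
    move: MB lnD0; rewrite -(mulr_natr M).
    have := ler_norm M.
    have : 0 <= n%:R :> R by [].
    have : 0 <= `|M| by [].
    move: `|M| (\sum_(l | _) _) (n%:R) (ln D) => m X v d m0 v0 mM MB d0 BX.
    have : 0 <= (m - M) * v by rewrite mulr_ge0// subr_ge0.
    rewrite !mulrDl !mulrDr; nra.
have [y yP] := choice pts.
pose F n (s : R) := y n (cell_index n s).
have [] := @helly R b F.
- by move=> n s t st; have [_ + _ _] := yP n; apply; [exact: cell_index_mono|exact: cell_index_le].
- by move=> n s; apply: Kb; have [+ _ _ _] := yP n; apply; exact: cell_index_le.
move=> sg [Q [S [sgk ndQ cS FQ]]].
have [mu [muK]] := @log_energy_finite R K S sg (fun k => y (sg k)) Q M' cK sgk
   (fun k => let: And4 h _ _ _ := yP (sg k) in h)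
   (fun k => let: And4 _ _ h _ := yP (sg k) in h)
   (fun k => let: And4 _ _ _ h := yP (sg k) in h) ndQ cS FQ.
by apply; exact: Kpolar.
Qed.

(** * The maximum principle *)

Definition is_d2 (R : realType) (f : R -> R) (x a : R) : Prop :=
  exists2 f' : R -> R, \forall y \near x, is_derive (y : R) (1 : R) f (f' y) & is_derive x (1 : R) f' a.

Lemma is_d2D (R : realType) (f g : R -> R) (x a b : R) :
  is_d2 f x a -> is_d2 g x b -> is_d2 (fun y => f y + g y) x (a + b).
Proof.
move=> [f' fd f'd] [g' gd g'd]; exists (fun y => f' y + g' y); last exact: is_deriveD.
near=> y; apply: is_deriveD; near: y; [exact: fd|exact: gd].
Unshelve. all: by end_near. Qed.

Lemma is_d2Z (R : realType) (f : R -> R) (c x a : R) :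
  is_d2 f x a -> is_d2 (fun y => c * f y) x (c * a).
Proof.
move=> [f' fd f'd]; exists (fun y => c * f' y); last exact: is_deriveZ.
near=> y; apply: is_deriveZ; near: y; exact: fd.
Unshelve. all: by end_near. Qed.

Lemma is_d2_cst (R : realType) (c x : R) : is_d2 (fun _ => c) x 0.
Proof.
exists (fun _ => 0); last exact: is_derive_cst.
by apply: (@nearW R (nbhs x)) => y; exact: is_derive_cst.
Qed.

Lemma is_d2_sqr (R : realType) (x : R) : is_d2 (fun y => y ^+ 2) x 2.
Proof.
exists (fun y => y + y); last exact: (is_deriveD (is_derive_id x 1) (is_derive_id x 1)).
by apply: (@nearW R (nbhs x)) => y; apply: is_derive_eq; rewrite /GRing.scale /= mulr1.
Qed.

(** The first derivative vanishes at [x]; if [a > 0] it is positive just to the right, and the mean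
    value theorem gives larger values of [f] there. *)
Lemma is_d2_local_max (R : realType) (f : R -> R) (x a : R) :
  (\forall y \near x, f y <= f x) -> is_d2 f x a -> a <= 0.
Proof.
move=> fmax [f' fd f'd]; rewrite leNgt; apply/negP => a0.
have [e /= e0 He] : exists2 e : R, 0 < e & forall y, `|x - y| < e ->
    f y <= f x /\ is_derive y 1 f (f' y).
  have : \forall y \near x, f y <= f x /\ is_derive y 1 f (f' y).
    by near=> y; split; near: y.
  by move=> /nbhs_ballP[e /= e0 He]; exists e.
have xI : x \in `]x - e, x + e[ by rewrite in_itv /= ltrBlDr !ltrDl e0.
have inI y : y \in `]x - e, x + e[ -> `|x - y| < e.
  by rewrite in_itv /= => /andP[y1 y2]; rewrite ltr_norml; apply/andP; split; lra.
have f'x : f' x = 0.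
  have D0 : is_derive x 1 f 0.
    apply: (@derive1_at_max _ f (x - e) (x + e)) => //; first by lra.
      by move=> y /inI/He[_ D]; exact: ex_derive.
    by move=> y /inI/He[].
  have [_ D] := He x (inI _ xI).
  by rewrite -(@derive_val _ _ _ _ _ _ _ D) (@derive_val _ _ _ _ _ _ _ D0).
have [d /= d0 Hd] : exists2 d : R, 0 < d & forall y, x < y -> y < x + d -> 0 < f' y.
  have [df' f'E] := f'd.
  have := df'; rewrite /derivable -/(derive f' x 1) => cf'.
  have /cvgr_gt/(_ 0) : (fun h : R => h^-1 *: (f' (h *: 1 + x) - f' x)) @ 0^' --> a.
    by rewrite -f'E; exact: cf'.
  move=> /(_ a0)/nbhs_ballP[d /= d0 Hd]; exists d => // y xy yd.
  have := Hd (y - x); rewrite /ball /= sub0r normrN gtr0_norm ?subr_gt0//.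
  rewrite ltrBlDl => /(_ yd); rewrite subr_eq0 gt_eqF// => /(_ isT).
  rewrite f'x subr0 /GRing.scale /= mulr1 subrK pmulr_rgt0//.
  by rewrite invr_gt0 subr_gt0.
pose m := Num.min (e / 2) (d / 2); pose y := x + m.
have m0 : 0 < m by rewrite lt_min !divr_gt0.
have me : m < e by rewrite gt_min ltr_pdivrMr// mulr_natr mulr2n ltrDl e0.
have md : m < d by rewrite gt_min [X in _ || X]ltr_pdivrMr// mulr_natr mulr2n ltrDl d0 orbT.
have xy : x < y by rewrite ltrDl.
have near_e t : x <= t -> t <= y -> `|x - t| < e.
  by rewrite /y => t1 t2; rewrite ltr_norml; apply/andP; split; lra.
have [| |c cI fc] := @MVT R f f' x y xy.
- move=> t; rewrite in_itv /= => /andP[t1 t2].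
  by have [] := He t (near_e _ (ltW t1) (ltW t2)).
- apply: derivable_within_continuous => t; rewrite in_itv /= => /andP[t1 t2].
  by have [_ D] := He t (near_e _ t1 t2); exact: ex_derive.
move: cI; rewrite in_itv /= => /andP[c1 c2].
have [fy _] := He y (near_e _ (ltW xy) (lexx _)).
have : 0 < f y - f x.
  rewrite fc mulr_gt0 ?subr_gt0//; apply: Hd => //.
  by rewrite (lt_trans c2)// /y ltrD2l.
by rewrite subr_gt0 ltNge fy.
Unshelve. all: by end_near. Qed.

(** The Euclidean distance from [p] to the real point [t], written out because the norm of [R * R]
    is the maximum norm. *)
Definition dst (R : realType) (p : R * R) (t : R) : R := Num.sqrt ((p.1 - t) ^+ 2 + p.2 ^+ 2).

Lemma dst_cabs (R : realType) (p : R * R) (t : R) : dst p t = cabs ((p.1 +i* p.2) - t%:C).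
Proof. by rewrite /dst /= subr0. Qed.

Lemma dst_ge0 (R : realType) (p : R * R) (t : R) : 0 <= dst p t.
Proof. exact: sqrtr_ge0. Qed.

Lemma dst_triangle (R : realType) (p : R * R) (t s : R) : dst p t <= dst p s + `|s - t|.
Proof.
have := @le_normcD R ((p.1 +i* p.2) - s%:C) (s%:C - t%:C).
rewrite addrA subrK -!dst_cabs => /le_trans; apply; rewrite lerD2l.
by rewrite /= subr0 expr0n addr0 sqrtr_sqr.
Qed.

Lemma le_dist_dst (R : realType) (p : R * R) (t s : R) : `|s - t| <= dst p s + dst p t.
Proof.
have := @le_normcD R (s%:C - (p.1 +i* p.2)) ((p.1 +i* p.2) - t%:C).
rewrite addrA subrK -dst_cabs (_ : cabs (s%:C - _) = dst p s); last first.
  by rewrite /dst /=; congr Num.sqrt; ring.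
by rewrite /= subr0 expr0n addr0 sqrtr_sqr.
Qed.

Lemma dst_move (R : realType) (p q : R * R) (t : R) :
  dst q t <= dst p t + (`|p.1 - q.1| + `|p.2 - q.2|).
Proof.
have := @le_normcD R ((p.1 +i* p.2) - t%:C) ((q.1 +i* q.2) - (p.1 +i* p.2)).
rewrite [X in cabs X <= _]addrC addrA subrK -!dst_cabs => /le_trans; apply.
rewrite lerD2l /= (distrC p.1) (distrC p.2); move: (q.1 - p.1) (q.2 - p.2) => c d.
rewrite -[leRHS]ger0_norm ?addr_ge0// -sqrtr_sqr ler_wsqrtr// sqrrD !real_normK ?num_real//.
by rewrite lerD2r lerDl mulrn_wge0// mulr_ge0.
Qed.

Lemma continuous_dst (R : realType) (t : R) : continuous (fun p : R * R => dst p t).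
Proof.
move=> p; have c1 : (fun q : R * R => q.1) @ p --> p.1 by exact: cvg_fst.
have c2 : (fun q : R * R => q.2) @ p --> p.2 by exact: cvg_snd.
have c1t : (fun q : R * R => q.1 - t) @ p --> p.1 - t by apply: cvgB => //; exact: cvg_cst.
have cq : (fun q : R * R => (q.1 - t) ^+ 2 + q.2 ^+ 2) @ p --> (p.1 - t) ^+ 2 + p.2 ^+ 2.
  exact: (cvgD (cvgM c1t c1t) (cvgM c2 c2)).
exact: (continuous_cvg _ (@sqrt_continuous R _) cq).
Qed.

Lemma norm1_le_dst (R : realType) (p : R * R) : `|p.1| <= dst p 0.
Proof. by rewrite /dst subr0 -sqrtr_sqr ler_wsqrtr// lerDl sqr_ge0. Qed.

Lemma norm2_le_dst (R : realType) (p : R * R) t : `|p.2| <= dst p t.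
Proof. by rewrite /dst -sqrtr_sqr ler_wsqrtr// lerDr sqr_ge0. Qed.

(** Only the restrictions of [u] to the two axis-parallel lines through [p] enter. This suffices for
    the maximum principle and reduces it to calculus in one variable. *)
Definition has_laplacian (R : realType) (u : R * R -> R) (p : R * R) (l : R) : Prop :=
  exists a b, [/\ is_d2 (fun x => u (x, p.2)) p.1 a, is_d2 (fun y => u (p.1, y)) p.2 b & a + b = l].

Lemma has_laplacianD (R : realType) (u v : R * R -> R) p l m :
  has_laplacian u p l -> has_laplacian v p m -> has_laplacian (fun q => u q + v q) p (l + m).
Proof.
move=> [a [b [ua ub <-]]] [c [d [vc vd <-]]]; exists (a + c), (b + d).
by split; [exact: is_d2D|exact: is_d2D|rewrite addrACA].
Qed.

Lemma has_laplacianZ (R : realType) (u : R * R -> R) c p l :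
  has_laplacian u p l -> has_laplacian (fun q => c * u q) p (c * l).
Proof.
move=> [a [b [ua ub <-]]]; exists (c * a), (c * b).
by split; [exact: is_d2Z|exact: is_d2Z|rewrite mulrDr].
Qed.

Lemma has_laplacian_cst (R : realType) c (p : R * R) : has_laplacian (fun _ => c) p 0.
Proof. by exists 0, 0; split; [exact: is_d2_cst|exact: is_d2_cst|rewrite addr0]. Qed.

Definition domain_off (R : realType) (X : set R) (r B : R) : set (R * R) :=
  [set w | (forall x, X x -> r <= dst w x) /\ dst w 0 <= B].

Lemma domain_off_compact (R : realType) (X : set R) (r B : R) : compact (domain_off X r B).
Proof.
have -> : domain_off X r B = (`[-B, B] `*` `[-B, B]) `&`
    ((\bigcap_(x in X) [set w | r <= dst w x]) `&` [set w | dst w 0 <= B]).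
  apply/seteqP; split => w /=; last by move=> [_ [h1 h2]]; split.
  move=> [h1 h2]; split; last by split.
  by split; rewrite /= in_itv /= -ler_norml; apply: le_trans h2;
     [exact: norm1_le_dst|exact: norm2_le_dst].
apply: compact_closedI; first by apply: compact_setX; exact: segment_compact.
apply: closedI.
  apply: closed_bigI => x _; rewrite -[X in closed X]/((fun w : R * R => dst w x) @^-1` [set y | r <= y]).
  apply: closed_comp => [w _|]; [exact: continuous_dst|exact: closed_ge].
rewrite -[X in closed X]/((fun w : R * R => dst w 0) @^-1` [set y | y <= B]).
apply: closed_comp => [w _|]; [exact: continuous_dst|exact: closed_le].
Qed.

(* Adding [e * x ^ 2] makes the Laplacian positive, so that a maximum cannot be interior. *)
Lemma max_principle (R : realType) (X : set R) (r B : R) (u : R * R -> R) :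
  0 < r ->
  (forall w, domain_off X r B w -> {for w, continuous u}) ->
  (forall w, domain_off X r B w -> has_laplacian u w 0) ->
  (forall w x, domain_off X r B w -> X x -> dst w x < 2 * r -> u w <= 0) ->
  (forall w, domain_off X r B w -> B - 1 <= dst w 0 -> u w <= 0) ->
  forall w, domain_off X r B w -> u w <= 0.
Proof.
move=> r0 cu lu nearX far w Aw; rewrite leNgt; apply/negP => uw.
pose A := domain_off X r B.
(* The perturbation stays below [u w / 2] on the domain, so [u] is still positive where [v] is
   maximal. *)
pose e := u w / (2 * (B ^+ 2 + 1)).
have B0 : 0 <= B by apply: le_trans (dst_ge0 _ _) Aw.2.
have e0 : 0 < e by rewrite divr_gt0// mulr_gt0// ltr_pwDr// sqr_ge0.
pose v (q : R * R) := u q + e * q.1 ^+ 2.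
have cv : {within A, continuous v}.
  apply: continuous_in_subspaceT => q /set_mem Aq.
  apply: cvgD; first exact: cu.
  apply: cvgM; first exact: cvg_cst.
  by rewrite expr2; under eq_fun do rewrite expr2; apply: cvgM; exact: cvg_fst.
have [q /set_mem Aq qmax] := compact_EVT_max (ex_intro _ w Aw) (@domain_off_compact R X r B) cv.
have uq : 0 < u q.
  have := qmax _ (mem_set Aw); rewrite /v.
  have : q.1 ^+ 2 <= B ^+ 2.
    rewrite -real_normK ?num_real// lerXn2r ?nnegrE//.
    by apply: le_trans (norm1_le_dst q) Aq.2.
  move=> q1 w1; have := mulr_ge0 (ltW e0) (sqr_ge0 w.1).
  have := ler_wpM2l (ltW e0) q1.
  have : e * (2 * (B ^+ 2 + 1)) = u w.
    by rewrite /e mulfVK// gt_eqF// mulr_gt0// ltr_pwDr// sqr_ge0.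
  by move: w1; move: (e * q.1 ^+ 2) (e * w.1 ^+ 2) => s t; rewrite !mulrDr mulr1; nra.
(* Since [u q > 0], the point [q] avoids both boundary layers, so every point within [r] and within
   1 of it is still in the domain: the maximum is interior. *)
have qr x : X x -> 2 * r <= dst q x.
  by move=> Xx; rewrite leNgt; apply/negP => /(nearX _ _ Aq Xx); rewrite leNgt uq.
have qB : dst q 0 < B - 1.
  by rewrite ltNge; apply/negP => /(far _ Aq); rewrite leNgt uq.
have near_q q' : `|q.1 - q'.1| + `|q.2 - q'.2| < r -> `|q.1 - q'.1| + `|q.2 - q'.2| < 1 -> v q' <= v q.
  move=> dr d1; apply: qmax; apply/mem_set; split => [x Xx|].
    have := dst_move q' q x; rewrite (distrC q'.1) (distrC q'.2).
    have := qr _ Xx; lra.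
  have := dst_move q q' 0; lra.
have [a [b [ua ub ab]]] := lu _ Aq.
have va : is_d2 (fun x => v (x, q.2)) q.1 (a + e * 2).
  by apply: is_d2D => //; apply: is_d2Z; exact: is_d2_sqr.
have vb : is_d2 (fun y => v (q.1, y)) q.2 (b + 0).
  by apply: is_d2D => //; exact: (is_d2_cst (e * q.1 ^+ 2) q.2).
have a0 : a + e * 2 <= 0.
  apply: is_d2_local_max va; apply/nbhs_ballP.
  exists (Num.min r 1) => [|x]; rewrite /ball /= lt_min ?r0 ?ltr01// => /andP[xr x1].
  by rewrite -surjective_pairing; apply: near_q; rewrite /= subrr normr0 addr0.
have b0 : b + 0 <= 0.
  apply: is_d2_local_max vb; apply/nbhs_ballP.
  exists (Num.min r 1) => [|x]; rewrite /ball /= lt_min ?r0 ?ltr01// => /andP[xr x1].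
  by rewrite -surjective_pairing; apply: near_q; rewrite /= subrr normr0 add0r.
lra.
Qed.

(** * Harmonic functions and logarithmic potentials *)

Lemma derivable_line_x (R : realType) (u : R * R -> R) (x y : R) :
  derivable u (x, y) (1, 0) -> is_derive x (1 : R) (fun t => u (t, y)) (dx u (x, y)).
Proof.
have E : (fun h : R => h^-1 *: (u (h *: ((1, 0) : R * R) + (x, y)) - u (x, y))) =
         (fun h : R => h^-1 *: (u (h *: (1 : R) + x, y) - u (x, y))).
  apply/funext => h; congr (_ *: (u (_, _) - _)).
  by rewrite /= /GRing.scale /= mulr0 add0r.
move=> du; apply: DeriveDef.
  by rewrite /derivable -E.
by rewrite /dx /derive -E.
Qed.

Lemma derivable_line_y (R : realType) (u : R * R -> R) (x y : R) :
  derivable u (x, y) (0, 1) -> is_derive y (1 : R) (fun t => u (x, t)) (dy u (x, y)).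
Proof.
have E : (fun h : R => h^-1 *: (u (h *: ((0, 1) : R * R) + (x, y)) - u (x, y))) =
         (fun h : R => h^-1 *: (u (x, h *: (1 : R) + y) - u (x, y))).
  apply/funext => h; congr (_ *: (u (_, _) - _)).
  by rewrite /= /GRing.scale /= mulr0 add0r.
move=> du; apply: DeriveDef.
  by rewrite /derivable -E.
by rewrite /dy /derive -E.
Qed.

Lemma near_line_x (R : realType) (U : set (R * R)) (p : R * R) :
  open U -> U p -> \forall x \near p.1, U (x, p.2).
Proof.
move=> oU Up; have := oU p Up => /nbhs_ballP[e /= e0 eU].
apply/nbhs_ballP; exists e => // x px; apply: eU; split => //=; exact: ballxx.
Qed.

Lemma near_line_y (R : realType) (U : set (R * R)) (p : R * R) :
  open U -> U p -> \forall y \near p.2, U (p.1, y).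
Proof.
move=> oU Up; have := oU p Up => /nbhs_ballP[e /= e0 eU].
apply/nbhs_ballP; exists e => // x px; apply: eU; split => //=; exact: ballxx.
Qed.

Lemma harmonic_laplacian (R : realType) (U : set (R * R)) (u : R * R -> R) (p : R * R) :
  open U -> harmonic_on U u -> U p -> has_laplacian u p 0.
Proof.
move=> oU [cu cdx cdy lapl] Up.
exists (dx (dx u) p), (dy (dy u) p); split; last exact: lapl.
- exists (fun x => dx u (x, p.2)).
    apply: filterS (near_line_x oU Up) => x Ux; apply: derivable_line_x.
    by have [] := cu _ Ux.
  rewrite [p in dx _ p]surjective_pairing; apply: derivable_line_x.
  by rewrite -surjective_pairing; have [] := cdx _ Up.
- exists (fun y => dy u (p.1, y)).
    apply: filterS (near_line_y oU Up) => y Uy; apply: derivable_line_y.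
    by have [] := cu _ Uy.
  rewrite [p in dy _ p]surjective_pairing; apply: derivable_line_y.
  by rewrite -surjective_pairing; have [] := cdy _ Up.
Qed.

Lemma mean_value_le (R : realType) (f f' : R -> R) (a b C : R) :
  (forall x, Num.min a b <= x <= Num.max a b -> is_derive x (1 : R) f (f' x) /\ `|f' x| <= C) ->
  `|f b - f a| <= C * `|b - a|.
Proof.
wlog ab : a b / a <= b.
  move=> wl fC; have [ab|ba] := leP a b; first exact: wl ab fC.
  rewrite distrC (distrC b); apply: wl; first exact: ltW.
  by move=> x; rewrite minC maxC; exact: fC.
rewrite (min_idPl ab) (max_idPr ab) => fC.
have [||c /[!in_itv]/= cab ->] := @MVT_segment R f f' a b ab.
- by move=> x; rewrite in_itv /= => /andP[ax xb]; have [|//] := fC x; rewrite !ltW.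
- apply: derivable_within_continuous => x; rewrite in_itv /= => xab.
  by have [D _] := fC x xab; exact: ex_derive.
by rewrite normrM ler_wpM2r//; have [] := fC c cab.
Qed.

(** Horizontally, [dx u] is bounded near [p] and the mean value theorem applies. Vertically, only
    the line through [p] matters, where [u] is differentiable at [p]. *)
Lemma C1_continuous (R : realType) (U : set (R * R)) (u : R * R -> R) (p : R * R) :
  open U -> C1_on U u -> U p -> {for p, continuous u}.
Proof.
move=> oU cu Up; have [_ dyp cdx _] := cu _ Up.
have [e /= e0 eU] : exists2 e : R, 0 < e & forall q : R * R, `|p.1 - q.1| < e -> `|p.2 - q.2| < e ->
    U q /\ `|dx u p - dx u q| < 1.
  have : \forall q \near p, U q /\ `|dx u p - dx u q| < 1.
    near=> q; split; near: q; first exact: oU.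
    by have /cvgrPdist_lt := cdx; apply.
  by move=> /nbhs_ballP[e /= e0 He]; exists e => // q q1 q2; exact: He.
pose C := `|dx u p| + 1.
have C0 : 0 < C by rewrite ltr_pwDr.
have horiz q : `|p.1 - q.1| < e -> `|p.2 - q.2| < e -> `|u q - u (p.1, q.2)| <= C * `|q.1 - p.1|.
  move=> q1 q2; have := @mean_value_le R (fun x => u (x, q.2)) (fun x => dx u (x, q.2)) p.1 q.1 C.
  rewrite /= -surjective_pairing; apply.
  move=> x /andP[x1 x2].
  have px : `|p.1 - x| < e.
    move: q1 x1 x2; rewrite !ltr_norml => /andP[q1 q1'].
    have [pq|/ltW pq] := leP p.1 q.1 => x1 x2; apply/andP; split; lra.
  have [Ux dux] := eU (x, q.2) px q2; have [dxu _ _ _] := cu _ Ux.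
  split; first exact: (derivable_line_x dxu).
  have := ler_normB (dx u p) (dx u p - dx u (x, q.2)); rewrite subKr => dx_le.
  by apply: le_trans dx_le _; rewrite /C lerD2l ltW.
have cy : {for p.2, continuous (fun y => u (p.1, y))}.
  apply: differentiable_continuous; apply/derivable1_diffP.
  apply: ex_derive; apply: derivable_line_y; by rewrite -surjective_pairing.
apply/cvgrPdist_lt => d d0; have d20 : 0 < d / 2 by rewrite divr_gt0.
have /cvgrPdist_lt/(_ _ d20)/nbhs_ballP[e' /= e'0 ye'] := cy.
have dC0 : 0 < d / 2 / C by rewrite divr_gt0.
have Bp : nbhs p (ball p (Num.min e (Num.min e' (d / 2 / C)))).
  by apply: nbhsx_ballx; rewrite !lt_min e0 e'0 dC0.
apply: filterS Bp => q [/= q1 q2]; move: q1 q2; rewrite /ball /= !lt_min.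
move=> /andP[h1 /andP[_ h3]] /andP[h2 /andP[/ye' h4 _]].
have := horiz q h1 h2; move: h3; rewrite ltr_pdivlMr// mulrC distrC => h3.
have := ler_normD (u p - u (p.1, q.2)) (u (p.1, q.2) - u q).
rewrite addrA subrK (distrC (u (p.1, q.2)) (u q)).
by move: h4; rewrite -surjective_pairing; lra.
Unshelve. all: by end_near. Qed.

(** * Logarithmic potentials of finite lists of real points *)

Definition lg (R : realType) (p : R * R) (t : R) : R := ln (dst p t).

Lemma lgE (R : realType) (p : R * R) (t : R) :
  lg p t = 2^-1 * ln ((p.1 - t) ^+ 2 + p.2 ^+ 2).
Proof.
rewrite /lg -[in RHS](@sqr_sqrtr R (_ + _)) ?addr_ge0 ?sqr_ge0// -/(dst p t).
have := dst_ge0 p t; rewrite le_eqVlt => /orP[/eqP <-|d0].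
  by rewrite expr0n /= !ln0// mulr0.
by rewrite lnXn// mulr2n; field.
Qed.

Lemma dst_gt0 (R : realType) (p : R * R) (t : R) : (0 < dst p t) = (0 < (p.1 - t) ^+ 2 + p.2 ^+ 2).
Proof. by rewrite /dst sqrtr_gt0. Qed.

Lemma is_derive_sqr_shift (R : realType) (t k x : R) :
  is_derive x (1 : R) (fun y : R => (y - t) ^+ 2 + k) (2 * (x - t)).
Proof.
have D1 : is_derive x (1 : R) (fun y : R => y - t) 1.
  have := is_deriveB (is_derive_id x (1 : R)) (is_derive_cst t x (1 : R)).
  by rewrite subr0.
apply: (is_derive_eq (is_deriveD (is_deriveM D1 D1) (is_derive_cst k x (1 : R)))).
by rewrite /GRing.scale /=; ring.
Qed.

Lemma is_d2_ln_sqr (R : realType) (t k x : R) : 0 < (x - t) ^+ 2 + k ->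
  is_d2 (fun y => ln ((y - t) ^+ 2 + k)) x (2 * (k - (x - t) ^+ 2) / ((x - t) ^+ 2 + k) ^+ 2).
Proof.
move=> k0.
have cq : {for x, continuous (fun y : R => (y - t) ^+ 2 + k)}.
  apply: differentiable_continuous; apply/derivable1_diffP.
  exact: (@ex_derive _ _ _ _ _ _ _ (is_derive_sqr_shift t k x)).
exists (fun y => ((y - t) ^+ 2 + k)^-1 * (2 * (y - t))).
  near=> y.
  have y0 : 0 < (y - t) ^+ 2 + k by near: y; have /cvgr_gt := cq; apply.
  exact: (@is_derive1_comp R (@ln R) (fun y : R => (y - t) ^+ 2 + k) y _ _ (is_derive1_ln y0) (is_derive_sqr_shift t k y)).
have D1 : is_derive x (1 : R) (fun y : R => y - t) 1.
  have := is_deriveB (is_derive_id x (1 : R)) (is_derive_cst t x (1 : R)).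
  by rewrite subr0.
have DV := @is_deriveV R (fun y : R => (y - t) ^+ 2 + k) x _ _ (lt0r_neq0 k0)
  (is_derive_sqr_shift t k x).
apply: (is_derive_eq (is_deriveM DV (is_deriveZ 2 D1))).
rewrite /GRing.scale /= mulr1 -[2 *: (x - t)]/(2 * (x - t)); field.
by rewrite gt_eqF.
Unshelve. all: by end_near. Qed.

Lemma lg_laplacian (R : realType) (p : R * R) (t : R) : 0 < dst p t ->
  has_laplacian (fun q => lg q t) p 0.
Proof.
rewrite dst_gt0 => p0; rewrite (_ : (fun q => _) = (fun q : R * R => 2^-1 * ln ((q.1 - t) ^+ 2 + q.2 ^+ 2))); last first.
  by apply/funext => q; rewrite lgE.
rewrite -(mulr0 2^-1); apply: has_laplacianZ.
exists (2 * (p.2 ^+ 2 - (p.1 - t) ^+ 2) / ((p.1 - t) ^+ 2 + p.2 ^+ 2) ^+ 2),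
       (2 * ((p.1 - t) ^+ 2 - (p.2 - 0) ^+ 2) / ((p.2 - 0) ^+ 2 + (p.1 - t) ^+ 2) ^+ 2).
split.
- exact: (is_d2_ln_sqr p0).
- rewrite (_ : (fun y => _) = (fun y => ln ((y - 0) ^+ 2 + (p.1 - t) ^+ 2))).
    by apply: is_d2_ln_sqr; rewrite subr0 addrC.
  by apply/funext => y; rewrite subr0 addrC.
- by rewrite subr0 [X in _ + _ / X ^+ 2]addrC -mulrDl -mulrDr addrACA; ring.
Qed.

Lemma lg_continuous (R : realType) (p : R * R) (t : R) : 0 < dst p t ->
  {for p, continuous (fun q => lg q t)}.
Proof.
by move=> p0; exact: (continuous_cvg _ (continuous_ln p0) (@continuous_dst R t p)).
Qed.

Definition sum_lg (R : realType) (T : seq R) (p : R * R) : R := \sum_(t <- T) lg p t.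

Lemma sum_lg_laplacian (R : realType) (T : seq R) (p : R * R) :
  (forall t, t \in T -> 0 < dst p t) -> has_laplacian (sum_lg T) p 0.
Proof.
elim: T => [|t T IH] T0.
  rewrite (_ : sum_lg [::] = fun _ => 0); first exact: has_laplacian_cst.
  by apply/funext => q; rewrite /sum_lg big_nil.
rewrite (_ : sum_lg _ = fun q => lg q t + sum_lg T q); last first.
  by apply/funext => q; rewrite /sum_lg big_cons.
rewrite -[X in has_laplacian _ _ X]addr0; apply: has_laplacianD.
  by apply: lg_laplacian; apply: T0; rewrite mem_head.
by apply: IH => s sT; apply: T0; rewrite inE sT orbT.
Qed.

Lemma sum_lg_continuous (R : realType) (T : seq R) (p : R * R) :
  (forall t, t \in T -> 0 < dst p t) -> {for p, continuous (sum_lg T)}.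
Proof.
elim: T => [|t T IH] T0.
  rewrite (_ : sum_lg [::] = fun _ => 0); first exact: cvg_cst.
  by apply/funext => q; rewrite /sum_lg big_nil.
rewrite (_ : sum_lg _ = fun q => lg q t + sum_lg T q); last first.
  by apply/funext => q; rewrite /sum_lg big_cons.
apply: cvgD.
  by apply: lg_continuous; apply: T0; rewrite mem_head.
by apply: IH => s sT; apply: T0; rewrite inE sT orbT.
Qed.

Lemma expR_sum_lg (R : realType) (T : seq R) (p : R * R) :
  (forall t, t \in T -> 0 < dst p t) -> expR (sum_lg T p) = \prod_(t <- T) dst p t.
Proof.
move=> T0; rewrite /sum_lg expR_sum big_seq [RHS]big_seq.
by apply: eq_bigr => t /T0 tp; rewrite lnK// posrE.
Qed.

Lemma sum_lg_le (R : realType) (T : seq R) (p : R * R) (c : R) :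
  (forall t, t \in T -> lg p t <= c) -> sum_lg T p <= c *+ size T.
Proof.
move=> Tc; rewrite /sum_lg big_seq; apply: le_trans (ler_sum _ Tc) _.
by rewrite -big_seq big_const_seq count_predT iter_addr_0.
Qed.

Lemma le_sum_lg (R : realType) (T : seq R) (p : R * R) (c : R) :
  (forall t, t \in T -> c <= lg p t) -> c *+ size T <= sum_lg T p.
Proof.
move=> Tc; rewrite /sum_lg big_seq; apply: le_trans (ler_sum _ Tc).
by rewrite -big_seq big_const_seq count_predT iter_addr_0.
Qed.

(** * Lower bounds for Fekete potentials *)

(** If [|s - t|] is at least [tau * r], moving from [s] to [w] shrinks the distance to [t] by a
    factor no smaller than [expR (- eps)]. Otherwise [ln |s - t|] is below [ln tau - m], and the
    term with [kappa] absorbs the loss [ln tau]. *)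
Lemma lg_ge_near (R : realType) (w : R * R) (s t eps kappa D m r : R) :
  0 < eps -> 0 < kappa -> 0 < r -> s != t -> 1 <= D -> `|s - t| <= D -> ln r = - m ->
  let tau := 2 / (1 - expR (- eps)) in
  ln tau * (1 + kappa) <= kappa * m ->
  dst w s < 2 * r -> r <= dst w t ->
  ln `|s - t| - eps - kappa * (ln D - ln `|s - t|) <= lg w t.
Proof.
move=> eps0 kappa0 r0 st D1 stD lnr tau tau_m ws wt.
have a0 : 0 < `|s - t| by rewrite normr_gt0 subr_eq0.
have D0 : 0 < D by apply: lt_le_trans stD.
have aD : ln `|s - t| <= ln D by rewrite ler_ln.
have e1 : 0 < 1 - expR (- eps) by rewrite subr_gt0 -[ltRHS]expR0 ltr_expR oppr_lt0.
have tau0 : 0 < tau by rewrite divr_gt0.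
have wt0 : 0 < dst w t by apply: lt_le_trans wt.
have taur0 : 0 < tau * r := mulr_gt0 tau0 r0.
have [ra|ar] := leP (tau * r) `|s - t|.
  have dw : `|s - t| * expR (- eps) <= dst w t.
    have h1 := le_dist_dst w t s.
    have : 2 * r <= (1 - expR (- eps)) * `|s - t|.
      apply: le_trans (ler_wpM2l (ltW e1) ra).
      by rewrite /tau mulrA mulrCA mulfV ?gt_eqF// mulr1.
    by rewrite mulrBl mul1r (mulrC _ (expR _)); lra.
  have : ln (`|s - t| * expR (- eps)) <= lg w t by rewrite /lg ler_ln// posrE mulr_gt0// expR_gt0.
  rewrite lnM ?posrE ?expR_gt0// expRK; apply: le_trans.
  by rewrite gerDl oppr_le0 mulr_ge0 ?subr_ge0// ltW.
have lw : ln `|s - t| - ln tau <= lg w t.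
  apply: (@le_trans _ _ (ln r)); last by rewrite /lg ler_ln.
  by rewrite lerBlDl -lnM ?posrE// ler_ln ?posrE//; exact: ltW.
have : ln `|s - t| <= ln tau - m.
  by rewrite -lnr -lnM ?posrE// ler_ln ?posrE//; exact: ltW.
move: lw tau_m; move: (ln `|s - t|) (ln tau) (lg w t) (ln D) (ln_ge0 D1) => a u v d d0 lw tau_m am.
have : kappa * (u - m) >= kappa * a by rewrite ler_pM2l.
have := mulr_ge0 (ltW kappa0) d0; move: tau_m.
rewrite !mulrBr mulrDr mulr1 (mulrC u); lra.
Qed.

Lemma fekete_near (R : realType) (n : nat) (x : 'I_n.+1 -> R) (B eps kappa D M0 r : R)
    (w : R * R) (i k : 'I_n.+1) :
  0 < eps -> 0 < kappa -> 0 <= M0 -> 1 <= D -> kappa * (ln D + M0) <= eps ->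
  injective x -> (forall k l, `|x k - x l| <= D) ->
  (forall k, B <= \sum_(l | l != k) ln `|x k - x l|) -> - (M0 * n%:R) <= B ->
  r = expR (- (eps * n%:R)) ->
  ln (2 / (1 - expR (- eps))) * (1 + kappa) <= kappa * (eps * n%:R) ->
  ln (D + 1) <= eps * n%:R -> 2 * r <= 1 ->
  (forall l, r <= dst w (x l)) -> dst w (x k) < 2 * r ->
  B - 4 * eps * n%:R <= \sum_(l | l != i) lg w (x l).
Proof.
move=> eps0 kappa0 M00 D1 kD xinj xD xB BM rE tau_n Dn r1 wr wk.
have r0 : 0 < r by rewrite rE expR_gt0.
have lnr : ln r = - (eps * n%:R) by rewrite rE expRK.
have sumk : B - 2 * eps * n%:R <= \sum_(l | l != k) lg w (x l).
  have : \sum_(l | l != k) ((1 + kappa) * ln `|x k - x l| - (eps + kappa * ln D)) <=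
      \sum_(l | l != k) lg w (x l).
    apply: ler_sum => l lk; apply: le_trans (lg_ge_near eps0 kappa0 r0 _ D1 (xD k l) lnr tau_n wk (wr l)).
      by rewrite le_eqVlt; apply/orP; left; apply/eqP; ring.
    by rewrite (inj_eq xinj) eq_sym.
  rewrite sumrB -mulr_sumr sumr_const cardC1 card_ord /= -[_ *+ n]mulr_natr.
  apply: le_trans.
  have := ler_wpM2l (ltW (ltr_wpDr (ltW kappa0) ltr01)) (xB k).
  have := ler_wpM2r (ler0n R n) kD.
  have := ler_wpM2l (ltW kappa0) BM.
  move: (\sum_(l | _) _) (n%:R) (ln D) => S v d h1 h2 h3.
  nra.
have all_split j : \sum_l lg w (x l) = lg w (x j) + \sum_(l | l != j) lg w (x l) by rewrite (bigD1 j).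
have wi : lg w (x i) <= ln (D + 1).
  rewrite /lg ler_ln ?posrE; last 2 first.
  - exact: lt_le_trans (wr i).
  - by rewrite ltr_wpDl// (le_trans ler01).
  have := dst_triangle w (x i) (x k); have := xD k i; lra.
have wkr : - (eps * n%:R) <= lg w (x k).
  by rewrite -lnr /lg ler_ln ?posrE// (lt_le_trans r0).
have := all_split i; rewrite (all_split k).
lra.
Qed.

Lemma sum_lg_others (R : realType) (n : nat) (x : 'I_n.+1 -> R) (i : 'I_n.+1) (w : R * R) :
  sum_lg (others x i) w = \sum_(l | l != i) lg w (x l).
Proof. by rewrite /sum_lg big_map big_filter big_enum_cond. Qed.

Lemma fekete_lower (R : realType) (n : nat) (x : 'I_n.+1 -> R) (B eps kappa D M0 r b : R)
    (w : R * R) (i : 'I_n.+1) :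
  (0 < n)%N -> (forall l, `|x l| <= b) ->
  0 < eps -> 0 < kappa -> 0 <= M0 -> 1 <= D -> kappa * (ln D + M0) <= eps ->
  injective x -> (forall k l, `|x k - x l| <= D) ->
  (forall k, B <= \sum_(l | l != k) ln `|x k - x l|) -> - (M0 * n%:R) <= B ->
  r = expR (- (eps * n%:R)) ->
  ln (2 / (1 - expR (- eps))) * (1 + kappa) <= kappa * (eps * n%:R) ->
  ln (D + 1) <= eps * n%:R -> 2 * r <= 1 ->
  (forall l, r <= dst w (x l)) ->
  B - 4 * eps * n%:R <= sum_lg (others x i) w.
Proof.
move=> n0 xb eps0 kappa0 M00 D1 kD xinj xD xB BM rE tau_n Dn r1 wr.
have r0 : 0 < r by rewrite rE expR_gt0.
pose T := others x i.
have TX t : t \in T -> range x t by move=> /mapP[l _ ->]; exists l.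
(* The disk contains [w], and in its outer layer all distances to the Fekete points are at least
   [expR |B|], so each of the [n >= 1] logarithms is at least [|B|]. *)
pose Bd := Num.max (dst w 0) (b + expR `|B| + 1).
pose u q := (B - 4 * eps * n%:R) + (-1) * sum_lg T q.
suff : u w <= 0 by rewrite /u mulN1r subr_le0.
have pos q : domain_off (range x) r Bd q -> forall t, t \in T -> 0 < dst q t.
  by move=> [qr _] t /TX /qr; exact: lt_le_trans.
apply: (@max_principle R (range x) r Bd u r0).
- move=> q /pos q0; apply: cvgD; first exact: cvg_cst.
  by apply: cvgM; [exact: cvg_cst|exact: sum_lg_continuous].
- move=> q /pos q0; rewrite -(addr0 0) -{2}(mulr0 (-1)).
  by apply: has_laplacianD; [exact: has_laplacian_cst|apply: has_laplacianZ; exact: sum_lg_laplacian].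
- move=> q _ [qr _] [k _ <-] qk; rewrite /u mulN1r subr_le0 sum_lg_others.
  apply: (fekete_near i eps0 kappa0 M00 D1 kD xinj xD xB BM rE tau_n Dn r1 _ qk).
  by move=> l; apply: qr; exists l.
- move=> q [qr qB] qfar; rewrite /u mulN1r subr_le0.
  apply: (@le_trans _ _ (`|B| *+ size T)); last first.
    apply: le_sum_lg => t /TX[l _ <-].
    have dq : expR `|B| <= dst q (x l).
      have := dst_triangle q 0 (x l); rewrite subr0; have := xb l.
      have : b + expR `|B| + 1 <= Bd by rewrite le_max lexx orbT.
      lra.
    by rewrite /lg -[leLHS]expRK ler_ln// posrE ?(lt_le_trans _ dq)// expR_gt0.
  rewrite size_others; apply: (@le_trans _ _ `|B|).
    rewrite lerBlDr; apply: le_trans (ler_norm B) _; rewrite lerDl.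
    by rewrite !mulr_ge0// ltW.
  by rewrite -[leLHS]mulr1n ler_wpMn2l.
- split; last by rewrite le_max lexx.
  by move=> _ [l _ <-].
Qed.

(** * Polynomials that are small on E and large at z *)

Lemma plane_offP (R : realType) (E : set R) (p : R * R) :
  plane_off E p <-> ~ (E p.1 /\ p.2 = 0).
Proof.
split => [Ep [E1 p2]|Ep [x Ex [xp p2]]].
  by apply: Ep; exists p.1 => //; rewrite p2.
by apply: Ep; split; rewrite -?xp -?p2.
Qed.

Lemma plane_off_dst_gt0 (R : realType) (E : set R) (p : R * R) (t : R) :
  plane_off E p -> E t -> 0 < dst p t.
Proof.
move=> /plane_offP Ep Et; rewrite lt_neqAle dst_ge0 andbT eq_sym; apply/eqP.
rewrite dst_cabs => /Normc.eq0_normc/eqP; rewrite subr_eq0 eq_complex /=.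
by move=> /andP[/eqP p1 /eqP p2]; apply: Ep; rewrite p1.
Qed.

Lemma plane_off_dst_ge (R : realType) (E : set R) (p : R * R) : compact E -> plane_off E p ->
  exists2 d : R, 0 < d & forall x, E x -> d <= dst p x.
Proof.
move=> cE Ep; have [d d0 dE] := off_dist cE Ep; exists d => // x Ex.
by have := dE x Ex; rewrite -normcN opprB dst_cabs.
Qed.

Lemma open_plane_off (R : realType) (E : set R) : compact E -> open (plane_off E).
Proof.
move=> cE; have clE : closed E by apply: compact_closed => //; exact: Rhausdorff.
have -> : plane_off E = ~` ((fun p : R * R => p.1) @^-1` E `&` (fun p : R * R => p.2) @^-1` [set 0]).
  by apply/seteqP; split => p; rewrite plane_offP.
apply: closed_openC; apply: closedI; apply: closed_comp => //.
- by move=> p _; exact: cvg_fst.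
- by move=> p _; exact: cvg_snd.
Qed.

Lemma near_dst (R : realType) (x : R) (P : set (R * R)) :
  (\forall p \near ((x, 0) : R * R), P p) -> exists2 e : R, 0 < e & forall p, dst p x < e -> P p.
Proof.
move=> /nbhs_ballP[e /= e0 He]; exists e => // p px; apply: He; split => /=.
  rewrite /ball /= distrC; apply: le_lt_trans px.
  by rewrite /dst -sqrtr_sqr ler_wsqrtr// lerDl sqr_ge0.
by rewrite /ball /= sub0r normrN; apply: le_lt_trans px; exact: norm2_le_dst.
Qed.

Lemma dst_real (R : realType) (x t : R) : dst (x, 0) t = `|x - t|.
Proof. by rewrite /dst /= expr0n addr0 sqrtr_sqr. Qed.

(** For empty [T] this is 0, as [0^-1 = 0]. That case may arise when there is no exceptional part of
    [E] to compensate. *)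
Definition mean_lg (R : realType) (T : seq R) (p : R * R) : R := (size T)%:R^-1 * sum_lg T p.

Lemma mean_lg_le (R : realType) (T : seq R) (p : R * R) (c : R) : 0 <= c ->
  (forall t, t \in T -> lg p t <= c) -> mean_lg T p <= c.
Proof.
move=> c0 /sum_lg_le; rewrite /mean_lg; have [->|T0] := posnP (size T).
  by rewrite invr0 mul0r.
by rewrite ler_pdivrMl ?ltr0n// mulr_natl.
Qed.

Lemma le_mean_lg (R : realType) (T : seq R) (p : R * R) (c : R) : c <= 0 ->
  (forall t, t \in T -> c <= lg p t) -> c <= mean_lg T p.
Proof.
move=> c0 /le_sum_lg; rewrite /mean_lg; have [->|T0] := posnP (size T).
  by rewrite invr0 mul0r.
by rewrite ler_pdivlMl ?ltr0n// mulr_natl.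
Qed.

(** A Lebesgue number argument: half the radius at [x] serves all points of [E] near [x]. *)
Lemma uniform_near (R : realType) (E : set R) (P : set (R * R)) : compact E ->
  (forall x, E x -> exists2 e : R, 0 < e & forall p, dst p x < e -> P p) ->
  exists2 e : R, 0 < e & forall p x, E x -> dst p x < e -> P p.
Proof.
move=> cE EP.
have cov : \forall e \near (0 : R)^'+, E `<=` (fun x => forall p, dst p x < e -> P p).
  have nE := (compact_near_coveringP E).1 cE.
  apply: (nE R ((0 : R)^'+) (fun e x => forall p, dst p x < e -> P p)) => x Ex; have [e e0 He] := EP x Ex.
  have e20 : 0 < e / 2 by rewrite divr_gt0.
  near=> x' i => p px'; apply: He.
  have x'x : `|x - x'| < e / 2 by near: x'; exact: nbhsx_ballx.
  have ie : i < e / 2 by near: i; exact: nbhs_right_lt.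
  apply: le_lt_trans (dst_triangle p x x') _; rewrite (splitr e); apply: ltrD.
    exact: lt_trans ie.
  by rewrite distrC.
have [e [e0 eE]] := filter_ex (filterI (nbhs_right_gt (0 : R)) cov).
by exists e => // p x /eE; apply.
Unshelve. all: by end_near. Qed.

Lemma expR_mean_lg_le (R : realType) (T : seq R) (p : R * R) (c : R) :
  T != [::] -> (forall t, t \in T -> 0 < dst p t) ->
  \prod_(t <- T) dst p t <= expR (c *+ size T) -> mean_lg T p <= c.
Proof.
move=> Tn0 T0; rewrite -expR_sum_lg// ler_expR /mean_lg => sc.
by rewrite ler_pdivrMl ?ltr0n ?lt0n ?size_eq0// mulr_natl.
Qed.

(* On the part of E where g does not tend to 0 a small multiple of the potential of
   [T] outweighs the bound of g, although this potential is harmless elsewhere. *)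
Lemma green_damped (R : realType) (E : set R) (g : R[i] -> R) (p0 : R * R) (eps : R) :
  compact E -> is_green E g -> plane_off E p0 -> 0 < eps ->
  exists (T : seq R) (theta r0 : R),
    [/\ 0 < theta /\ 0 < r0, forall t, t \in T -> E t,
        2 * theta * on_plane g p0 <= eps, - eps <= theta * mean_lg T p0 &
        forall p x, plane_off E p -> E x -> dst p x < r0 ->
          on_plane g p + theta * mean_lg T p <= 2 * eps].
Proof.
move=> cE [g0 _ gbnd _ [Z [mZ Zpolar] gZ]] Ep0 eps0.
have clE : closed E by apply: compact_closed => //; exact: Rhausdorff.
pose G := on_plane g.
have dst_pos := @plane_off_dst_gt0 R E.
have [d0 d00 dE] := plane_off_dst_ge cE Ep0.
have [b b0 bE] := compact_norm_bound cE.
have [Bg' GB'] := gbnd (b + 1); pose Bg := `|Bg'|.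
have GB p : plane_off E p -> dst p 0 <= b + 1 -> G p <= Bg.
  move=> Ep pb; apply: le_trans (ler_norm Bg'); apply: GB' => //.
  by move: pb; rewrite dst_cabs subr0.
pose L := ln (2 * b + 1); pose l0 := `|ln d0|.
have L0 : 0 <= L by rewrite ln_ge0// lerDr mulr_ge0.
have l00 : 0 <= l0 by exact: normr_ge0.
have G0 p : 0 <= G p by exact: g0.
have Bg0 : 0 <= Bg by exact: normr_ge0.
(* As [theta * den = eps], the effect of [theta] is at most [eps] in three places: against [L],
   which bounds the mean potential near [E] from above, against [l0], which bounds it from below at
   [p0], and against [2 * G p0]. *)
pose den := 1 + L + l0 + 2 * G p0.
have den0 : 0 < den by rewrite /den -!addrA ltr_pwDl// !addr_ge0// mulr_ge0.
pose theta := eps / den.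
have th0 : 0 < theta by rewrite divr_gt0.
have th_le c : 0 <= c -> c <= den -> theta * c <= eps.
  by move=> c0 cd; rewrite /theta mulrAC ler_pdivrMr// ler_wpM2l// ltW.
(* [O] collects the real points near which [G] is at most [eps]. The rest of [E] is compact and lies
   in the polar set [Z], because [G] tends to 0 at the points of [E] outside [Z]. *)
pose O : set R := [set x | exists2 rho : R, 0 < rho &
  forall p, dst p x < rho -> plane_off E p -> G p <= eps].
have oO : open O.
  rewrite openE => x [rho rho0 rhoG]; have rho20 : 0 < rho / 2 by rewrite divr_gt0.
  apply/nbhs_ballP; exists (rho / 2) => // x' xx'; exists (rho / 2) => // p px'.
  apply: rhoG; apply: le_lt_trans (dst_triangle p x x') _.
  by rewrite (splitr rho); apply: ltrD => //; rewrite distrC.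
pose K := E `&` ~` O.
have cK : compact K by apply: compact_closedI => //; exact: open_closedC.
have KZ : K `<=` Z.
  move=> x [Ex nOx]; apply: contrapT => nZx; apply: nOx.
  have /cvgrPdist_le/(_ _ eps0) := gZ x Ex nZx.
  move=> /near_dst[rho rho0 rhoG]; exists rho => // p prho Ep.
  by have := rhoG p prho Ep; rewrite sub0r normrN ger0_norm.
have Kpolar (mu : probability R R) : mu (~` K) = 0%E -> log_energy mu = +oo%E.
  by apply: (Zpolar mu K).
(* The 1 is given up in passing by continuity from [K] to nearby points of the plane;
   [theta * (M - 1) = Bg] then cancels the bound of [G]. *)
pose M := Bg / theta + 1.
have [T [TK Tn0 Tsmall]] := polar_small_poly M cK Kpolar.
have TE t : t \in T -> E t by move=> /TK[].
have loc x : E x -> exists2 e : R, 0 < e & forall p, dst p x < e ->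
    plane_off E p -> G p + theta * mean_lg T p <= 2 * eps.
  move=> Ex; have [[rho rho0 rhoG]|nOx] := pselect (O x).
    exists (Num.min rho 1); first by rewrite lt_min rho0 ltr01.
    move=> p; rewrite lt_min => /andP[prho p1] Ep.
    have : theta * mean_lg T p <= theta * L.
      rewrite ler_pM2l//; apply: mean_lg_le => // t /TE Et.
      rewrite /lg /L ler_ln ?posrE ?dst_pos//; last by rewrite ltr_wpDl// mulr_ge0.
      have := dst_triangle p t x; have := ler_normB x t; have := bE x Ex; have := bE t Et; lra.
    have : theta * L <= eps by apply: th_le => //; rewrite /den; have := G0 p0; lra.
    have := rhoG p prho Ep; lra.
  have Kx : K x by [].
  have T0 : T != [::] by apply: Tn0; exists x.
  have sT : (0 < size T)%N by rewrite lt0n size_eq0.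
  have cPhi : {for (x, 0), continuous (fun p : R * R => \prod_(t <- T) dst p t)}.
    apply: continuous_big => [|t _]; [exact: mul_continuous|exact: continuous_dst].
  have lt_Phi : \prod_(t <- T) dst (x, 0) t < expR ((- (M - 1)) *+ size T).
    under eq_bigr do rewrite dst_real.
    apply: le_lt_trans (Tsmall x Kx) _; rewrite ltr_expR mulNrn ltrN2 ltrMn2r.
    by rewrite sT /= ltrBlDr ltrDl.
  have /near_dst[e e0 ePhi] : \forall p \near ((x, 0) : R * R),
      \prod_(t <- T) dst p t < expR ((- (M - 1)) *+ size T).
    by have /cvgr_lt := cPhi; apply.
  exists (Num.min e 1); first by rewrite lt_min e0 ltr01.
  move=> p; rewrite lt_min => /andP[pe p1] Ep.
  have : mean_lg T p <= - (M - 1).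
    apply: expR_mean_lg_le => //; first by move=> t /TE; exact: dst_pos.
    by apply: ltW; exact: ePhi.
  have thM : theta * (M - 1) = Bg by rewrite /M addrK mulrCA mulfV ?mulr1// gt_eqF.
  rewrite -(ler_pM2l th0) mulrN thM.
  have : G p <= Bg.
    apply: GB => //; have := dst_triangle p 0 x; rewrite subr0; have := bE x Ex; lra.
  lra.
have [r0 r00 r0E] := uniform_near cE loc.
exists T, theta, r0; split => //.
- by rewrite -/(G p0) mulrAC mulrC; apply: th_le; rewrite ?mulr_ge0// /den; lra.
- have : - l0 <= mean_lg T p0.
    apply: le_mean_lg => [|t /TE Et]; first by rewrite oppr_le0.
    apply: (@le_trans _ _ (ln d0)); first by rewrite lerNl /l0 -normrN ler_norm.
    by rewrite /lg ler_ln ?posrE ?dst_pos// dE.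
  rewrite -(ler_pM2l th0) mulrN; apply: le_trans; rewrite lerN2.
  by apply: th_le => //; rewrite /den; have := G0 p0; lra.
- by move=> p x Ep Ex px; exact: (r0E p x Ex px Ep).
Qed.

Lemma expRN_le (R : realType) (m c : R) : 0 < c -> `|ln c| <= m -> expR (- m) <= c.
Proof.
move=> c0 cm; rewrite -[leRHS]lnK ?posrE// ler_expR lerNl.
by apply: le_trans cm; rewrite -normrN ler_norm.
Qed.

(** If all families fail, so do the Fekete points with one point omitted. The maximum principle then
    bounds [g] at [p0] by [a] plus a multiple of [eps] too small to allow this. *)
Lemma green_poly_infinite (R : realType) (E : set R) (g : R[i] -> R) (p0 : R * R) (a : R) :
  compact E -> is_green E g -> plane_off E p0 -> infinite_set E -> 0 <= a -> a < on_plane g p0 ->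
  exists (T : seq R) (B : R),
    [/\ T != [::], forall t, t \in T -> E t,
        forall x, E x -> \prod_(t <- T) `|x - t| <= expR B &
        B + a *+ size T <= sum_lg T p0].
Proof.
move=> cE gE Ep0 infE a0 ag; apply: contrapT => nT.
have [g0 harm _ [r1 [M1 growth]] _] := gE.
(* The errors at [p0] add up to at most [8 * eps], less than [G p0 - a = 10 * eps]. *)
pose G := on_plane g; pose eps : R := (G p0 - a) / 10.
have eps0 : 0 < eps by rewrite divr_gt0// subr_gt0.
have dst_pos := @plane_off_dst_gt0 R E.
have [d0 d00 dE] := plane_off_dst_ge cE Ep0.
have [b b0 bE] := compact_norm_bound cE.
pose D : R := 2 * b + 1.
have D1 : 1 <= D by rewrite lerDr mulr_ge0.
have lnD0 : 0 <= ln D by rewrite ln_ge0.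
have DE x y : E x -> E y -> `|x - y| <= D.
  by move=> /bE xb /bE yb; have := ler_normB x y; rewrite /D; lra.
have [T [theta [r0 [[th0 r00] TE thG thp0 nearE]]]] := green_damped cE gE Ep0 eps0.
pose M0 : R := `|a - ln d0|.
have M00 : 0 <= M0 by exact: normr_ge0.
pose kappa : R := eps / (ln D + M0 + 1).
have den0 : 0 < ln D + M0 + 1 by rewrite ltr_wpDl// addr_ge0.
have k0 : 0 < kappa by rewrite divr_gt0.
have kD : kappa * (ln D + M0) <= eps.
  by rewrite /kappa mulrAC ler_pdivrMr//; apply: ler_wpM2l; [exact: ltW|rewrite lerDl].
pose tau : R := 2 / (1 - expR (- eps)).
(* The summands are what [eps * n] has to exceed: the condition on [tau], [ln (D + 1)], and the
   bounds [1 / 2], [r0 / 2] and [d0] for [r = expR (- (eps * n))]. *)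
pose C : R := `|ln tau * (1 + kappa) / kappa| + `|ln (D + 1)| + `|ln (2^-1 : R)| + `|ln (r0 / 2)| + `|ln d0|.
have [n n0 nC] : exists2 n : nat, (0 < n)%N & C <= eps * n%:R.
  exists (Num.truncn (C / eps)).+1 => //.
  by rewrite mulrC -ler_pdivrMr// ltW// truncnS_gt.
have nR0 : 0 < n%:R :> R by rewrite ltr0n.
have C1 := normr_ge0 (ln tau * (1 + kappa) / kappa).
have C2 := normr_ge0 (ln (D + 1)).
have C3 := normr_ge0 (ln (2^-1 : R)).
have C4 := normr_ge0 (ln (r0 / 2)).
have C5 := normr_ge0 (ln d0).
have tau_n : ln tau * (1 + kappa) <= kappa * (eps * n%:R).
  rewrite [leRHS]mulrC -ler_pdivrMr//; apply: le_trans (ler_norm _) _.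
  by apply: le_trans nC; rewrite /C; lra.
have Dn : ln (D + 1) <= eps * n%:R.
  by apply: le_trans (ler_norm _) _; apply: le_trans nC; rewrite /C; lra.
pose r := expR (- (eps * n%:R)).
have r_1 : 2 * r <= 1.
  suff : r <= 2^-1 by lra.
  by apply: expRN_le => //; apply: le_trans nC; rewrite /C; lra.
have r_r0 : 2 * r <= r0.
  suff : r <= r0 / 2 by lra.
  by apply: expRN_le; [rewrite divr_gt0|apply: le_trans nC; rewrite /C; lra].
have r_d0 : r <= d0.
  by apply: expRN_le => //; apply: le_trans nC; rewrite /C; lra.
have r_gt0 : 0 < r by exact: expR_gt0.
have [x [B [xE xinj xB [i xiB]]]] := fekete_log n cE infE.
pose U := others x i.
have UE t : t \in U -> E t := @mem_others R E n x i xE t.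
have sU : size U = n by exact: size_others.
have U0 : U != [::] by rewrite -size_eq0 sU -lt0n.
have BU : sum_lg U p0 < B + a * n%:R.
  rewrite ltNge; apply/negP => le_U; apply: nT; exists U, B; split => //.
    by move=> y Ey; rewrite prod_others; exact: xiB.
  by rewrite sU -mulr_natr.
(* The assumed failure of [U] bounds [B] from below, as the potential at [p0] is at least
   [n * ln d0]. *)
have BM : - (M0 * n%:R) <= B.
  have : ln d0 * n%:R <= sum_lg U p0.
    rewrite mulr_natr -sU; apply: le_sum_lg => t /UE Et.
    by rewrite /lg ler_ln ?posrE ?dst_pos// dE.
  have : (a - ln d0) * n%:R <= M0 * n%:R by rewrite ler_wpM2r// ler_norm.
  rewrite mulrBl; lra.
have lower q : (forall y, E y -> r <= dst q y) -> B - 4 * eps * n%:R <= sum_lg U q.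
  move=> qr; apply: (fekete_lower i n0 (fun l => bE _ (xE l)) eps0 k0 M00 D1 kD xinj
    (fun k l => DE _ _ (xE k) (xE l)) xB BM (erefl r) tau_n Dn r_1).
  by move=> l; exact: qr.
pose c0 := (1 + 2 * theta) * (B / n%:R - 4 * eps) - 2 * eps.
(* The first two terms grow at most like [(1 + theta) * ln |q|]; the coefficient [1 + 2 * theta]
   therefore makes [u] negative far away. Near [E] the constant [c0] makes [u <= 0], by the lower
   bound for [sum_lg U]. *)
pose u q := G q + theta * mean_lg T q + (- ((1 + 2 * theta) / n%:R) * sum_lg U q + c0).
(* The value of [ln |q|] from which the surplus [theta * ln |q|] outweighs all constants. *)
pose l1 := (M1 + (1 + 3 * theta) * ln 2 + c0) / theta.
pose Bd := dst p0 0 + (2 * b + 2) + `|r1| + expR `|l1| + 1.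
have uE q : u q = G q + theta * mean_lg T q
    - (1 + 2 * theta) * ((sum_lg U q - B) / n%:R + 4 * eps) - 2 * eps.
  by rewrite /u /c0; field; rewrite gt_eqF.
have th1 : 0 <= 1 + 2 * theta by rewrite addr_ge0// mulr_ge0// ltW.
have offA q : domain_off E r Bd q -> plane_off E q.
  by move=> [qr _]; apply/plane_offP => -[Eq q2]; have := qr _ Eq;
    rewrite /dst subrr q2 expr0n addr0 sqrtr0 leNgt r_gt0.
have up0 : u p0 <= 0.
  apply: (@max_principle R E r Bd u r_gt0).
  - move=> q Aq; have Eq := offA _ Aq.
    have Tq t : t \in T -> 0 < dst q t by move=> /TE; exact: dst_pos.
    have Uq t : t \in U -> 0 < dst q t by move=> /UE; exact: dst_pos.
    apply: cvgD.
      apply: cvgD; first by apply: (C1_continuous (open_plane_off cE) _ Eq); have [] := harm.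
      apply: cvgM; first exact: cvg_cst.
      by apply: cvgM; [exact: cvg_cst|exact: sum_lg_continuous].
    apply: cvgD; last exact: cvg_cst.
    by apply: cvgM; [exact: cvg_cst|exact: sum_lg_continuous].
  - move=> q Aq; have Eq := offA _ Aq.
    have Tq t : t \in T -> 0 < dst q t by move=> /TE; exact: dst_pos.
    have Uq t : t \in U -> 0 < dst q t by move=> /UE; exact: dst_pos.
    have lG : has_laplacian G q 0 by exact: harmonic_laplacian (open_plane_off cE) harm Eq.
    have lT := has_laplacianZ theta (has_laplacianZ (size T)%:R^-1 (sum_lg_laplacian Tq)).
    have lU := has_laplacianZ (- ((1 + 2 * theta) / n%:R)) (sum_lg_laplacian Uq).
    have := has_laplacianD (has_laplacianD lG lT) (has_laplacianD lU (has_laplacian_cst c0 q)).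
    by rewrite !mulr0 !addr0.
  - move=> q y Aq Ey qy; rewrite uE.
    have := nearE q y (offA _ Aq) Ey (lt_le_trans qy r_r0).
    have : 0 <= (1 + 2 * theta) * ((sum_lg U q - B) / n%:R + 4 * eps).
      rewrite mulr_ge0// -lerBlDr sub0r ler_pdivlMr//.
      by have := lower q Aq.1; lra.
    rewrite -/(G q); lra.
  - move=> q Aq qfar; have Eq := offA _ Aq.
    pose l := ln (dst q 0).
    have el0 := expR_ge0 `|l1|; have p00 := dst_ge0 p0 0; have r1n := ler_norm r1.
    have r10 := normr_ge0 r1.
    have q2b : 2 * b + 2 <= dst q 0 by move: qfar; rewrite /Bd; lra.
    have q_r1 : r1 <= dst q 0 by move: qfar; rewrite /Bd; lra.
    have q_l1 : expR `|l1| <= dst q 0 by move: qfar; rewrite /Bd; lra.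
    have q0 : 0 < dst q 0 by apply: lt_le_trans q_l1; exact: expR_gt0.
    have ll1 : l1 <= l.
      by apply: le_trans (ler_norm l1) _; rewrite -[leLHS]expRK /l ler_ln ?posrE ?expR_gt0.
    have l0 : 0 <= l by rewrite ln_ge0//; move: q2b b0; lra.
    have ln20 : 0 <= ln (2 : R) by rewrite ln_ge0// ler1n.
    have Gq : G q <= l + M1.
      have cq : cabs (q.1 +i* q.2) = dst q 0 by rewrite dst_cabs subr0.
      have := growth (q.1 +i* q.2) Eq; rewrite cq => /(_ q_r1).
      by rewrite ler_norml => /andP[_]; rewrite lerBlDl.
    have Tq : theta * mean_lg T q <= theta * (ln 2 + l).
      rewrite ler_pM2l//; apply: mean_lg_le => [|t /TE Et]; first exact: addr_ge0.
      have t0 := dst_pos q t Eq Et; rewrite /l -lnM ?posrE// /lg ler_ln ?posrE ?mulr_gt0//.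
      by have := dst_triangle q t 0; rewrite sub0r normrN; have := bE t Et; move: q2b b0; lra.
    have Uq : (l - ln 2) * n%:R <= sum_lg U q.
      rewrite mulr_natr -sU; apply: le_sum_lg => t /UE Et.
      have t0 := dst_pos q t Eq Et.
      rewrite lerBlDr /l /lg -lnM ?posrE// ler_ln ?posrE ?mulr_gt0//.
      by have := dst_triangle q 0 t; rewrite subr0; have := bE t Et; move: q2b b0; lra.
    have : - ((1 + 2 * theta) / n%:R) * sum_lg U q <= - (1 + 2 * theta) * (l - ln 2).
      rewrite !mulNr lerN2 -[leRHS]mulrA [n%:R^-1 * _]mulrC; apply: ler_wpM2l => //.
      by rewrite ler_pdivlMr.
    have : theta * l1 <= theta * l by rewrite ler_pM2l.
    have -> : theta * l1 = M1 + (1 + 3 * theta) * ln 2 + c0.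
      by rewrite /l1 mulrCA mulfV ?mulr1// gt_eqF.
    by rewrite /u; nra.
  - split; first by move=> y Ey; apply: le_trans r_d0 (dE y Ey).
    have el0 := expR_ge0 `|l1|; have r10 := normr_ge0 r1.
    by rewrite /Bd; lra.
move: up0 BU thG thp0; rewrite uE -/(G p0) => up0 BU thG thp0.
have Pn : (sum_lg U p0 - B) / n%:R <= a.
  by rewrite ler_pdivrMr// lerBlDl ltW.
have : (1 + 2 * theta) * ((sum_lg U p0 - B) / n%:R + 4 * eps) <= (1 + 2 * theta) * (a + 4 * eps).
  by apply: ler_wpM2l => //; rewrite lerD2r.
have epsE : 10 * eps = G p0 - a by rewrite /eps mulrCA mulfV ?mulr1.
have : 2 * theta * (a + 4 * eps) <= 2 * theta * G p0.
  by apply: ler_wpM2l; [rewrite mulr_ge0// ltW|lra].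
by move: up0; rewrite !mulrDl !mul1r; lra.
Qed.

Lemma cabs_prod (R : realType) (T : seq R) (F : R -> R[i]) :
  cabs (\prod_(t <- T) F t) = \prod_(t <- T) cabs (F t).
Proof.
elim: T => [|t T IH]; first by rewrite !big_nil Normc.normc1.
by rewrite !big_cons Normc.normcM IH.
Qed.

(** The empty set is polar, since no probability measure gives the whole line measure 0. *)
Lemma not_polar_neq0 (R : realType) (E : set R) : ~ polar E -> E !=set0.
Proof.
move=> nE; apply/set0P/eqP => E0; apply: nE => mu K _; rewrite E0 subset0 => -> mu0.
by have := probability_setT mu; rewrite -setC0 mu0 => /eqP; rewrite eq_sym onee_eq0.
Qed.

(** For finite [E] the product over all its points vanishes on [E], so [B] is free and is chosen to
    give equality at [p0]. *)
Lemma green_poly (R : realType) (E : set R) (g : R[i] -> R) (p0 : R * R) (a : R) :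
  compact E -> E !=set0 -> is_green E g -> plane_off E p0 -> 0 <= a -> a < on_plane g p0 ->
  exists (T : seq R) (B : R),
    [/\ T != [::], forall t, t \in T -> E t,
        forall x, E x -> \prod_(t <- T) `|x - t| <= expR B &
        B + a *+ size T <= sum_lg T p0].
Proof.
move=> cE [x0 Ex0] gE Ep0 a0 ag; have [finE|infE] := pselect (finite_set E); last first.
  exact: green_poly_infinite cE gE Ep0 infE a0 ag.
have /finite_seqP[T ET] := finE; exists T, (sum_lg T p0 - a *+ size T); split.
- by apply: contraTneq isT => T0; move: Ex0; rewrite ET T0.
- by move=> t; rewrite ET.
- move=> x; rewrite ET /= => xT; rewrite (big_rem x)//= subrr normr0 mul0r.
  exact: expR_ge0.
- by rewrite subrK.
Qed.

Lemma approx_poly (R : realType) (E : set R) (g : R[i] -> R) (z : R[i]) (a : R) :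
  compact E -> ~ polar E -> is_green E g -> off E z -> a < g z ->
  exists2 C0 : R, 0 <= C0 & forall m, exists p : {poly R[i]},
    [/\ (size p <= m.+1)%N, p.[z] = 1 &
        forall x, E x -> cabs p.[x%:C] <= C0 * expR (- (a *+ m))].
Proof.
(* For [a < 0] the bound is at least 1 and the constant polynomial 1 suffices. *)
move=> cE nE gE Ez az; have [a0|a0] := leP 0 a; last first.
  exists 1 => // m; exists 1; split; rewrite ?size_poly1 ?hornerE// => x _.
  by rewrite hornerE Normc.normc1 ?mul1r -[leLHS]expR0 ler_expR oppr_ge0 mulrn_wle0// ltW.
have zE : z = complex.Re z +i* complex.Im z by case: z {Ez az}.
pose p0 := (complex.Re z, complex.Im z).
have dz t : dst p0 t = cabs (z - t%:C) by rewrite dst_cabs [in RHS]zE.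
have Ep0 : plane_off E p0 by rewrite /plane_off /= -zE.
have ag : a < on_plane g p0 by rewrite /on_plane /= -zE.
have [T [B [T0 TE TB Bz]]] := green_poly cE (not_polar_neq0 nE) gE Ep0 a0 ag.
pose q : {poly R[i]} := \prod_(t <- T) ('X - (t%:C)%:P).
have qE w : q.[w] = \prod_(t <- T) (w - t%:C).
  by rewrite horner_prod; apply: eq_bigr => t _; rewrite !hornerE.
have Tpos t : t \in T -> 0 < dst p0 t by move=> /TE; exact: plane_off_dst_gt0.
have qz : cabs q.[z] = expR (sum_lg T p0).
  by rewrite expR_sum_lg// qE cabs_prod; apply: eq_bigr => t _; rewrite dz.
have qz0 : q.[z] != 0.
  by apply: contraTneq (expR_gt0 (sum_lg T p0)); rewrite -qz => ->; rewrite Normc.normc0 ltxx.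
exists (expR (a *+ size T)); first exact: expR_ge0.
apply: (@poly_decay R E z a (expR B) (size T) q) => //.
- by rewrite lt0n size_eq0.
- by rewrite size_prod_XsubC.
- move=> x Ex; rewrite qE cabs_prod; apply: le_trans (TB x Ex).
  rewrite le_eqVlt; apply/orP; left; apply/eqP; apply: eq_bigr => t _.
  by rewrite /= subr0 expr0n addr0 sqrtr_sqr.
- by rewrite qz -expRD ler_expR.
Qed.

Theorem theorem3p8 (R : realType) (E : set R) (z : R[i]) (g : R[i] -> R)
    (Fam : forall n : nat, set 'M[R]_n) :
  compact E -> ~ polar E ->
  is_green E g ->
  off E z ->
  (forall n (H : 'M[R]_n), Fam n H -> H^T = H) ->
  (exists s : nat, forall n (H : 'M[R]_n), Fam n H -> sparse_mx H s) ->
  (forall n (H : 'M[R]_n), Fam n H -> lead_spectra_in E H) ->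
  forall a : R, a < g z ->
  exists C : R,
    forall (n : nat) (H : 'M[R]_n), Fam n H ->
    forall L D : 'M[R[i]]_n, is_LDL (cmx H - z%:M) L D ->
    forall i j : 'I_n, (j <= i)%N ->
      ((cabs (L i j))%:E <= C%:E * expeR (- (a%:E * level H i j)))%E.
Proof.
move=> cE nE gE Ez Hsym Hsp Hspec a az.
have [C0 C00 key] := approx_poly cE nE gE Ez az.
exact: decay_from_poly cE Ez Hsym Hsp Hspec C00 key.
Qed.
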